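(* Let $G$ be a $4$-regular plane graph of mincut $4$ with $n$ vertices, root-vertex $v^*$, and an even regular decomposition $(T_1^*,\dots,T_4^* )$; place each non-root vertex $v$ at $\mathrm{p}(v)=(x(v),y(v))$. Then: (a) for every edge $e=\{u,v\}$ not incident to $v^*$, the ray in direction $i$ from $\mathrm{p}(u)$ and the ray in direction $j$ from $\mathrm{p}(v)$ intersect in a single point $\mathrm{p}(e)$, where $i$ and $j$ are the colors of the arcs $(u,e)$ and $(v,e)$; (b) drawing each such edge as $[\mathrm{p}(u),\mathrm{p}(e)]\cup[\mathrm{p}(e),\mathrm{p}(v)]$ gives a planar orthogonal drawing of $G\setminus v^*$ in the grid $\{0,\dots,n-2\}^2$ with exactly one bend per edge, with the following properties: (1) each line and each column of the grid $\{0,\dots,n-2\}^2$ contains exactly one vertex; (2) for each $i$, $T_i^*$ consists exactly of the arcs $(u,e)$ ($u\neq v^*$) such that the vector from $\mathrm{p}(u)$ to $\mathrm{p}(e)$ points down, left, up, right for $i=1,2,3,4$ respectively; (3) every non-root face $f$ has two distinct edges $\{a,a'\}$ and $\{b,b'\}$ (called special) such that, if $f$ is black, going clockwise around $f$: the bent-edge from $a$ to $a'$ is right-down, each bent-edge on the portion of the contour from $a'$ to $b$ is left-down, the bent-edge from $b$ to $b'$ is left-up, each bent-edge on the portion from $b'$ to $a$ is right-up, and $x(a)+1=x(b)$, $y(a')+1=y(b')$; if $f$ is white, the same holds with right, down, left, up replaced by up, right, down, left respectively, and $x(a')-1=x(b')$, $y(a)+1=y(b)$. (c) The vertex $v^*$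 and its four incident edges can be added to obtain a planar orthogonal drawing of $G$ using $3$ more rows, $3$ more columns and $8$ additional bends (one bend on two of the root-edges and three bends on the other two); the resulting drawing of $G$ lies in an $(n+1)\times(n+1)$ grid and has $2n+4$ bends in total.
   Context: Graphs are finite, loopless, possibly with multiple edges; a plane graph is a connected planar graph with a fixed crossing-free drawing. Mincut = minimum number of edges whose deletion disconnects the graph. Colors are modulo $4$. Root-edges $e_1^*,\dots,e_4^*$ are the edges at $v^*$ in counterclockwise order; root-faces are the faces incident to $v^*$, the other $n-2$ faces are non-root faces. A regular decomposition is a covering of the edges by spanning trees $T_1^*,\dots,T_4^*$, each oriented toward $v^*$, such that: (i) each edge not incident to $v^*$ is in exactly two trees with opposite orientations; (ii) $e_i^*$ is only in $T_i^*$; (iii) around each non-root vertex the edges leading to its parent in $T_1^*,\dots,T_4^*$ appear in clockwise order. It is even if each edge not incident to $v^*$ lies in two trees of indices of different parities. The arcs of $T_i^*$ (oriented toward $v^*$) have color $i$. $P_i(v)$ is the directed path from $v$ to $v^*$ in $T_i^*$; $P_i(v)\cup P_{i+2}(v)$ is a simple cycle and $R_{i,i+2}(v)$ is the region it bounds containing $e_{i+1}^*$; $x(v)$ (resp. $y(v)$) is the number of non-root faces in $R_{1,3}(v)$ (resp. $R_{4,2}(v)$). The faces of $G$ are properly colored black/white (faces sharing an edge have different colors), the root-face between $e_4^*$ and $e_1^*$ being black. The ray in direction $1$ (resp. $2,3,4$) from a point goes in the negative $y$ (resp. negative $x$, positive $y$, positive $x$) direction. A bent-edge $[\mathrm{p}(u),\mathrm{p}(e)]\cup[\mathrm{p}(e),\mathrm{p}(w)]$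 traversed from $u$ to $w$ is called ''$X$-$Y$'' (e.g. right-down) if the segment from $\mathrm{p}(u)$ to $\mathrm{p}(e)$ goes in direction $X$ and the segment from $\mathrm{p}(e)$ to $\mathrm{p}(w)$ goes in direction $Y$ (up, down, left, right meaning positive $y$, negative $y$, negative $x$, positive $x$). *)

(* Defs.v *)
From mathcomp Require Export all_boot all_order all_fingroup all_algebra.

Set Implicit Arguments.
Unset Strict Implicit.
Unset Printing Implicit Defensive.

Import Order.TTheory GRing.Theory Num.Theory.

(* A plane graph is encoded, up to orientation-preserving homeomorphism of the
   sphere, as a connected combinatorial map of genus 0.  A dart is an edge
   together with one of its two orientations ([org] is its origin, [opp]
   reverses it), and [ccw d] is the next dart around [org d] in
   counterclockwise order.  Parallel edges are allowed.
   Turning counterclockwise around the head of [d], from the reversed dart to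
   the next one, sweeps the corner on the right of [d].  Hence the orbits of
   [d |-> ccw (opp d)] are the faces: the orbit of [d] is the face on the
   right of [d], and iterating this permutation goes clockwise around it.
   Planarity is Euler's formula. *)

Definition arc_rel (D V : finType) (org : D -> V) (opp : {perm D})
    (A : {set D}) : rel V :=
  [rel u w | [exists d in A, (org d == u) && (org (opp d) == w)]].

Record planeMap : Type := PlaneMap {
  dart : finType;
  vertex : finType;
  org : dart -> vertex;
  opp : {perm dart};
  ccw : {perm dart};
  oppK : involutive opp;
  opp_neq : forall d, opp d != d;
  org_ccw : forall d d', (org d == org d') = (d' \in porbit ccw d);
  org_surj : forall v, exists d, org d = v;
  loopless : forall d, org (opp d) != org d;
  map_connected : forall u w, connect (arc_rel org opp [set: dart]) u w;
  euler : #|vertex| + #|porbits (opp * ccw)%g| = #|porbits opp| + 2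
}.

Section Maps.
Variable G : planeMap.
Implicit Types (d : dart G) (v : vertex G) (A : {set dart G}).

Definition tgt d : vertex G := org (opp G d).
Definition fnext : {perm dart G} := (opp G * ccw G)%g.
Definition face d : {set dart G} := porbit fnext d.
Definition faces : {set {set dart G}} := porbits fnext.
Definition edge d : {set dart G} := porbit (opp G) d.
Definition edges : {set {set dart G}} := porbits (opp G).
Definition degree v : nat := #|[set d | org d == v]|.

Definition disconnects (S : {set {set dart G}}) : Prop :=
  exists u w,
    ~~ connect (arc_rel (@org G) (opp G) [set d | edge d \notin S]) u w.

Definition has_mincut (k : nat) : Prop :=
  (exists S : {set {set dart G}}, [/\ S \subset edges, disconnects S & #|S| = k]) /\
  (forall S : {set {set dart G}}, S \subset edges -> disconnects S -> k <= #|S|).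

Definition face_coloring (black : {set dart G} -> bool) : Prop :=
  forall d, black (face (opp G d)) = ~~ black (face d).

Section Rooted.
Variable root : vertex G.

Definition nonroot_dart d : bool := (org d != root) && (tgt d != root).

(* The corner between [d] and the next dart clockwise around [org d] belongs
   to [face d], so the faces incident to [root] are those containing a dart
   of origin [root]. *)
Definition nonroot_faces : {set {set dart G}} :=
  [set f in faces | [forall d in f, org d != root]].

Local Open Scope ring_scope.

(* Colors are elements of ['Z_4]; color 4 is [0]. *)
Implicit Types (i j : 'Z_4) (T : 'Z_4 -> {set dart G}) (e : 'Z_4 -> dart G).

(* [e i] is the root-edge of index [i], directed out of [root]. *)
Definition root_edges e : Prop :=
  forall i, org (e i) = root /\ e (i + 1) = ccw G (e i).

(* Spanning tree oriented toward [root], given by its arcs (from child to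
   parent): every other vertex has a unique parent arc, and following the
   arcs leads to [root]. *)
Definition spanning_tree A : Prop :=
  [/\ forall d, d \in A -> org d != root,
      forall v, v != root -> exists! d, d \in A /\ org d = v
    & forall v, connect (arc_rel (@org G) (opp G) A) v root].

Definition regular_decomposition e T : Prop :=
  [/\ forall i, spanning_tree (T i),
      forall d, nonroot_dart d -> exists i j, i != j /\
        forall k, (d \in T k) = (k == i) /\ (opp G d \in T k) = (k == j),
      forall i k, e i \notin T k /\ (opp G (e i) \in T k) = (k == i)
    & (* clockwise order of the four parent arcs around a vertex of degree 4 *)
      forall i d d', d \in T i -> d' \in T (i + 1) -> org d = org d' ->
        d = ccw G d'].

Definition even_decomposition T : Prop :=
  forall i j d, nonroot_dart d -> d \in T i -> opp G d \in T j ->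
    odd i != odd j.

(* The arcs of the directed path P_i(v) from [v] to the root in T_i: since
   every vertex has at most one outgoing arc in T_i, they are the arcs of T_i
   whose origin is reachable from [v]. *)
Definition path_arcs T i v : {set dart G} :=
  [set d in T i | connect (arc_rel (@org G) (opp G) (T i)) v (org d)].

(* R_{i,i+2}(v), as a set of faces: the faces that can be reached from those
   incident to the root-edge of index i+1 without crossing an edge of
   P_i(v) or P_{i+2}(v). *)
Definition region e T i v : {set {set dart G}} :=
  let C := path_arcs T i v :|: path_arcs T (i + 2%:R) v in
  let step := [rel d d' | (d' == fnext d) ||
                 [&& d' == opp G d, d \notin C & opp G d \notin C]] in
  [set face d | d : dart G & connect step (e (i + 1)) d].

Definition xcoord e T v : nat := #|nonroot_faces :&: region e T 1 v|.
Definition ycoord e T v : nat := #|nonroot_faces :&: region e T 0 v|.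

End Rooted.
End Maps.

Section Geometry.
Variable R : realFieldType.
Local Open Scope ring_scope.

Definition point : Type := (R * R)%type.
Implicit Types (p q : point) (i : 'Z_4).

Definition dir i : point :=
  match nat_of_ord i with
  | 1%N => (0, -1)
  | 2%N => (-1, 0)
  | 3%N => (0, 1)
  | _ => (1, 0)
  end.

Definition right_ : 'Z_4 := 0.
Definition down_ : 'Z_4 := 1.
Definition left_ : 'Z_4 := 2%:R.
Definition up_ : 'Z_4 := 3%:R.

Definition ray i p q : Prop :=
  exists2 t : R, 0 <= t & q = (p.1 + t * (dir i).1, p.2 + t * (dir i).2).

(* the vector from [p] to [q] is nonzero and points in direction [i] *)
Definition points i p q : Prop :=
  exists2 t : R, 0 < t & q = (p.1 + t * (dir i).1, p.2 + t * (dir i).2).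

Definition on_segment (s : point * point) q : Prop :=
  exists2 t : R, 0 <= t <= 1 &
    q = ((1 - t) * s.1.1 + t * s.2.1, (1 - t) * s.1.2 + t * s.2.2).

Definition segments (s : seq point) : seq (point * point) := zip s (behead s).

Definition on_polyline (s : seq point) q : Prop :=
  exists2 u, u \in segments s & on_segment u q.

Definition simple_polyline (s : seq point) : Prop :=
  forall (u0 : point * point) (j k : nat) q,
    (j < k < size (segments s))%N ->
    on_segment (nth u0 (segments s) j) q ->
    on_segment (nth u0 (segments s) k) q ->
    k = j.+1 /\ q = (nth u0 (segments s) k).1.

Definition horizontal (u : point * point) : bool :=
  (u.1.2 == u.2.2) && (u.1.1 != u.2.1).
Definition vertical (u : point * point) : bool :=
  (u.1.1 == u.2.1) && (u.1.2 != u.2.2).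

(* Nondegenerate horizontal and vertical segments in alternation, so that
   every intermediate point is a bend. *)
Definition orthogonal_polyline (s : seq point) : Prop :=
  all (fun u => horizontal u || vertical u) (segments s) /\
  sorted (fun u w => horizontal u != horizontal w) (segments s).

(* [q] is a node of the grid {x0, ..., x0+m} x {y0, ..., y0+m} *)
Definition in_grid (x0 y0 : int) (m : nat) q : Prop :=
  exists a b : int, [/\ q = (a%:~R, b%:~R),
    x0 <= a <= x0 + m%:Z & y0 <= b <= y0 + m%:Z].

Section Drawings.
Variables (G : planeMap) (pos : vertex G -> point).
Variable bends : dart G -> seq point.
Implicit Types (d : dart G) (A : {set dart G}) (W : {set vertex G}).

Definition polyline d : seq point := pos (org d) :: rcons (bends d) (pos (tgt d)).

(* the dart [d] leaves its origin in direction [i] *)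
Definition leaves d i : Prop :=
  points i (pos (org d)) (head (pos (tgt d)) (bends d)).

(* A planar orthogonal drawing of the plane subgraph with vertex set [W] and
   set of darts [A] (closed under [opp]).  The last clause says that the drawing
   respects the plane embedding: the drawn darts occur in the same cyclic
   order around each vertex.  Directions decrease by one modulo 4 in a
   counterclockwise quarter turn. *)
Definition orthogonal_drawing W A : Prop :=
  (forall d, d \in A -> bends (opp G d) = rev (bends d)) /\
  {in W &, injective pos} /\
  (forall d, d \in A ->
     orthogonal_polyline (polyline d) /\ simple_polyline (polyline d)) /\
  (forall v d, v \in W -> d \in A -> on_polyline (polyline d) (pos v) ->
     v = org d \/ v = tgt d) /\
  (forall d d' q, d \in A -> d' \in A -> edge d != edge d' ->
     on_polyline (polyline d) q -> on_polyline (polyline d') q ->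
     exists v, [/\ q = pos v, v \in [set org d; tgt d]
                 & v \in [set org d'; tgt d']]) /\
  (forall d (a b : nat) (i j k : 'Z_4),
     (0 < a < b)%N -> (b < #|porbit (ccw G) d|)%N ->
     d \in A -> iter a (ccw G) d \in A -> iter b (ccw G) d \in A ->
     leaves d i -> leaves (iter a (ccw G) d) j -> leaves (iter b (ccw G) d) k ->
     exists a' b' : nat,
       [/\ (0 < a' < b')%N, (b' < 4)%N, j = i - a'%:R & k = i - b'%:R]).

(* each edge is counted once for each of its two darts *)
Definition nb_bends : nat := (\sum_(d : dart G) size (bends d))./2.

Definition drawn_node q : Prop :=
  (exists v, q = pos v) \/ (exists d, q \in bends d).

End Drawings.

Section Faces.
Variables (G : planeMap) (pos : vertex G -> point) (pe : dart G -> point).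

(* with [d] an edge from [u] to [w]: the bent-edge [u, pe d, w] is "X-Y" *)
Definition bent (X Y : 'Z_4) (d : dart G) : Prop :=
  points X (pos (org d)) (pe d) /\ points Y (pe d) (pos (tgt d)).

(* [d] and [iter m (fnext G) d] are the special edges (a,a') and (b,b'),
   directed clockwise around the face [face d]; r, dn, l, u play the roles of
   right, down, left, up *)
Definition special_contour (r dn l u : 'Z_4) (d : dart G) (m : nat) : Prop :=
  [/\ (0 < m < #|face d|)%N /\ edge (iter m (fnext G) d) != edge d,
      bent r dn d,
      forall k, (0 < k < m)%N -> bent l dn (iter k (fnext G) d),
      bent l u (iter m (fnext G) d)
    & forall k, (m < k < #|face d|)%N -> bent r u (iter k (fnext G) d)].

End Faces.
End Geometry.

(* Main.v *)
Require Import Defs.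
From mathcomp Require Import zify lra.
Import Order.TTheory GRing.Theory Num.Theory.
Set Implicit Arguments.
Unset Strict Implicit.
Unset Printing Implicit Defensive.
Local Open Scope ring_scope.

(** At a dart of color c the reverse dart has color c + 1 or c - 1, and the contour
    of the face on the right keeps its color in the first case and switches to
    c + 2 in the second (a "turn").  Every edge not at the root carries one turn,
    so there are 2(n - 2) of them.  A nonroot face has at least two, because trees
    contain no cycle, and Euler's formula gives at least n - 2 nonroot faces; hence
    a nonroot face has exactly two turns (which yield its special edges) and a root
    face has none.

    Planarity of the paths is obtained without the Jordan curve theorem: each
    curve P_i(v) + P_(i+2)(v) is the boundary modulo 2 of a set of faces.  This
    holds for the curve along the two root-faces at e_(i+1), and passing from one
    turn of a nonroot face f to the other one adds f to the set.  Starting at the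
    neighbor of the root along e_(i+1), this process swallows the nonroot faces one
    by one and visits every nonroot vertex once, so the regions are nested and the
    coordinates are bijective.

    Since regions are nested, every subtree of T_i or T_(i+2) is an interval for the
    coordinate counted by R_(i,i+2).  This is why two perpendicular arms can only
    meet at the bend of a common edge; parallel arms lie on different lines.  The
    root is placed outside of the box, at (-1, -1). *)

(** Regions are defined by reachability, so a set of faces whose boundary modulo 2 is the curve of
    [v] only bounds the region from above: a search starting at [e (i + 1)] cannot leave it. That
    the whole set is reached is carried along the sweep: faces already reached stay reachable, since
    an edge between two of them is not on the new boundary, and the added face adjoins them across
    an edge of the old curve. Evenness makes the calculus modulo 2 faithful: the reverse of an arc
    of color [i] never has color [i] or [i + 2], so P_i(v) and P_(i+2)(v) share no edge and nothing
    cancels. Everything is done for a general color [i], with one counting function for the four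
    rotations: color 1 gives x, color 0 gives y, and [i] and [i + 2] give complementary counts. *)

Lemma Z4P (i : 'Z_4) : [\/ i = 0, i = 1, i = 2%:R | i = 3%:R].
Proof.
case: i => -[|[|[|[|//]]]] lti;
  by [constructor 1; apply/val_inj | constructor 2; apply/val_inj
     | constructor 3; apply/val_inj | constructor 4; apply/val_inj].
Qed.

Ltac split_hyps := repeat match goal with
  | H : _ \/ _ |- _ => destruct H
  | H : _ /\ _ |- _ => destruct H
  | H : or3 _ _ _ |- _ => destruct H
  | H : or4 _ _ _ _ |- _ => destruct H
  end.

(** * Axis-parallel polylines *)

Section PlaneGeometry.
Variable R : realFieldType.
Implicit Types (p q u w : point R) (i j : 'Z_4) (M : R).

Definition between (a b c : R) := (a <= c /\ c <= b) \/ (b <= c /\ c <= a).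

(** All segments of the drawing are axis-parallel, so nothing is lost by replacing a segment with
    its bounding box, and linear arithmetic then suffices. *)
Lemma on_segment_box p q r : on_segment (p, q) r ->
  between p.1 q.1 r.1 /\ between p.2 q.2 r.2.
Proof.
have conv (a b t : R) : 0 <= t -> t <= 1 -> between a b ((1 - t) * a + t * b).
  by move=> t0 t1; case: (lerP a b) => ab; [left|right]; split; nra.
by case=> t /andP[t0 t1] ->; split; apply: conv.
Qed.

Lemma on_polyline3 (a b c q : point R) : on_polyline [:: a; b; c] q ->
  on_segment (a, b) q \/ on_segment (b, c) q.
Proof. by case=> s; rewrite !inE => /orP[]/eqP->; [left | right]. Qed.

Lemma on_polyline5 (a b c d f q : point R) : on_polyline [:: a; b; c; d; f] q ->
  [\/ on_segment (a, b) q, on_segment (b, c) q, on_segment (c, d) q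
    | on_segment (d, f) q].
Proof.
by case=> s; rewrite !inE => /or4P[]/eqP->;
  [constructor 1 | constructor 2 | constructor 3 | constructor 4].
Qed.

Lemma simple_polyline3 (a b c : point R) :
  (forall q, on_segment (a, b) q -> on_segment (b, c) q -> q = b) ->
  simple_polyline [:: a; b; c].
Proof.
move=> H u0 j k q jk; have [-> ->] : j = 0%N /\ k = 1%N by move: jk => /=; lia.
by move=> s s'; split=> //; apply: H.
Qed.

Lemma simple_polyline5 (a b c d f : point R) :
    (forall q, on_segment (a, b) q -> on_segment (b, c) q -> q = b) ->
    (forall q, on_segment (b, c) q -> on_segment (c, d) q -> q = c) ->
    (forall q, on_segment (c, d) q -> on_segment (d, f) q -> q = d) ->
    (forall q, on_segment (a, b) q -> on_segment (c, d) q -> False) ->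
    (forall q, on_segment (a, b) q -> on_segment (d, f) q -> False) ->
    (forall q, on_segment (b, c) q -> on_segment (d, f) q -> False) ->
  simple_polyline [:: a; b; c; d; f].
Proof.
move=> H1 H2 H3 H4 H5 H6 u0 j k q jk.
have : [\/ j = 0%N /\ k = 1%N, j = 1%N /\ k = 2%N, j = 2%N /\ k = 3%N
  | [\/ j = 0%N /\ k = 2%N, j = 0%N /\ k = 3%N | j = 1%N /\ k = 3%N]].
  case/andP: jk => /= jk k4.
  case: k k4 jk => [|[|[|[|k]]]] //= _; case: j => [|[|[|j]]] //= _;
    by [constructor 1 | constructor 2 | constructor 3
       | constructor 4; constructor 1 | constructor 4; constructor 2
       | constructor 4; constructor 3].
by move=> [[-> ->]|[-> ->]|[-> ->]|[[-> ->]|[-> ->]|[-> ->]]] /= s s';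
  first [by case: (H4 _ s s') | by case: (H5 _ s s') | by case: (H6 _ s s')
        | by split=> //; exact: (H1 _ s s') | by split=> //; exact: (H2 _ s s')
        | by split=> //; exact: (H3 _ s s')].
Qed.

Lemma points_ray i p q : points i p q -> ray i p q.
Proof. by case=> t t0 ->; exists t => //; apply: ltW. Qed.

Lemma ray_axis i p q : ray i p q -> if odd i then q.1 = p.1 else q.2 = p.2.
Proof.
by case: (Z4P i) => -> [t _ ->] /=; rewrite mulr0 addr0.
Qed.

Lemma pointsE i p q : points i p q <->
  match nat_of_ord i with
  | 1%N => q.1 = p.1 /\ q.2 < p.2
  | 2%N => q.1 < p.1 /\ q.2 = p.2
  | 3%N => q.1 = p.1 /\ p.2 < q.2
  | _ => p.1 < q.1 /\ q.2 = p.2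
  end.
Proof.
case: p q => p1 p2 [q1 q2]; case: (Z4P i) => -> /=; split.
1,3,5,7: by case=> t t0 [-> ->] /=; split; lra.
- by case=> lt eq; exists (q1 - p1); [lra | congr pair => /=; lra].
- by case=> eq lt; exists (p2 - q2); [lra | congr pair => /=; lra].
- by case=> lt eq; exists (p1 - q1); [lra | congr pair => /=; lra].
- by case=> eq lt; exists (q2 - p2); [lra | congr pair => /=; lra].
Qed.

Lemma points_uniq i j p q : points i p q -> points j p q -> i = j.
Proof.
by case: (Z4P i) => ->; case: (Z4P j) => -> /pointsE /= [a b] /pointsE /= [c d];
  first [done | exfalso; lra].
Qed.

Lemma between_eq (a c : R) : between a a c -> c = a.
Proof. by case=> -[c1 c2]; apply/eqP; rewrite eq_le ?c1 ?c2. Qed.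

(** The orientation is dropped so that a polyline and its reverse, drawn by the two darts of an
    edge, are handled by the same facts. *)
Definition axis i p q := points i p q \/ points i q p.

Lemma axis_sym i p q : axis i p q -> axis i q p.
Proof. by case; [right | left]. Qed.

Lemma axisE i p q : axis i p q ->
  if odd i then p.1 = q.1 /\ p.2 != q.2 else p.2 = q.2 /\ p.1 != q.1.
Proof.
by case=> /pointsE; case: (Z4P i) => -> /= [? ?]; split=> //;
  first [by rewrite lt_eqF | by rewrite gt_eqF].
Qed.

Lemma axis_horizontal i p q : axis i p q -> horizontal (p, q) = ~~ odd i.
Proof.
move/axisE; rewrite /horizontal /=; case: (odd i) => -[-> ne] //=.
  by rewrite eqxx andbF.
by rewrite eqxx ne.
Qed.

Lemma axis_vertical i p q : axis i p q -> vertical (p, q) = odd i.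
Proof.
move/axisE; rewrite /vertical /=; case: (odd i) => -[-> ne] //=.
  by rewrite eqxx ne.
by rewrite eqxx andbF.
Qed.

Lemma axis_meet i j p q w r : axis i p q -> axis j q w -> odd i != odd j ->
  on_segment (p, q) r -> on_segment (q, w) r -> r = q.
Proof.
move=> /axisE Hi /axisE Hj par /on_segment_box[/= b1 b2] /on_segment_box[/= b3 b4].
rewrite (surjective_pairing r) (surjective_pairing q); move: par Hi Hj.
case: (odd i); case: (odd j) => // _ [e1 _] [e2 _].
  by rewrite e1 in b1; rewrite -e2 in b4; rewrite (between_eq b1) (between_eq b4).
by rewrite e1 in b2; rewrite -e2 in b3; rewrite (between_eq b2) (between_eq b3).
Qed.

Lemma orthogonal3 i j (a b c : point R) : axis i a b -> axis j b c ->
  odd i != odd j -> orthogonal_polyline [:: a; b; c].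
Proof.
move=> ab bc; rewrite /orthogonal_polyline /=.
rewrite !(axis_horizontal ab, axis_vertical ab, axis_horizontal bc, axis_vertical bc).
by case: (odd i); case: (odd j).
Qed.

Lemma orthogonal5 i j k l (a b c d f : point R) :
  axis i a b -> axis j b c -> axis k c d -> axis l d f ->
  [&& odd i != odd j, odd j != odd k & odd k != odd l] ->
  orthogonal_polyline [:: a; b; c; d; f].
Proof.
move=> ab bc cd df; rewrite /orthogonal_polyline /=.
rewrite !(axis_horizontal ab, axis_vertical ab, axis_horizontal bc, axis_vertical bc,
  axis_horizontal cd, axis_vertical cd, axis_horizontal df, axis_vertical df).
by case: (odd i); case: (odd j); case: (odd k); case: (odd l).
Qed.

Lemma elbow_polyline i j p q w : axis i p q -> axis j q w -> odd i != odd j ->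
  orthogonal_polyline [:: p; q; w] /\ simple_polyline [:: p; q; w].
Proof.
move=> pq qw par; split; first exact: orthogonal3 pq qw par.
by apply: simple_polyline3 => r; apply: axis_meet pq qw par.
Qed.

Lemma on_segment_sym p q r : on_segment (p, q) r -> on_segment (q, p) r.
Proof.
case=> t /andP[t0 t1] ->; exists (1 - t); first by apply/andP; split; lra.
by congr pair => /=; lra.
Qed.

Definition in_box M p := [/\ 0 <= p.1, p.1 <= M, 0 <= p.2 & p.2 <= M].

Definition on_side M i p :=
  match nat_of_ord i with
  | 1%N => p.2 = 0
  | 2%N => p.1 = 0
  | 3%N => p.2 = M
  | _ => p.1 = M
  end.

Definition root_point : point R := (-1, -1).

(** Here [p] lies on side [i] of the box. Sides 1 and 2 face the root, and one elbow is enough. From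
    sides 3 and 0 the edge must go around the box, along the lines [M + 1] and [-2], in order to
    reach the root from the two directions that are still free. *)
Definition root_bends M i p : seq (point R) :=
  match nat_of_ord i with
  | 1%N => [:: (p.1, -1)]
  | 2%N => [:: (-1, p.2)]
  | 3%N => [:: (p.1, M + 1); (- 2%:R, M + 1); (- 2%:R, -1)]
  | _ => [:: (M + 1, p.2); (M + 1, - 2%:R); (-1, - 2%:R)]
  end.

(** The points of the polyline as inequalities, the same for both directions of travel, in a form
    that [lra] can use. *)
Definition root_line M i p q :=
  match nat_of_ord i with
  | 1%N => (q.1 = p.1 /\ -1 <= q.2 <= p.2) \/ (q.2 = -1 /\ -1 <= q.1 <= p.1)
  | 2%N => (q.2 = p.2 /\ -1 <= q.1 <= p.1) \/ (q.1 = -1 /\ -1 <= q.2 <= p.2)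
  | 3%N => [\/ q.1 = p.1 /\ p.2 <= q.2 <= M + 1,
               q.2 = M + 1 /\ - 2%:R <= q.1 <= p.1,
               q.1 = - 2%:R /\ -1 <= q.2 <= M + 1
             | q.2 = -1 /\ - 2%:R <= q.1 <= -1]
  | _ => [\/ q.2 = p.2 /\ p.1 <= q.1 <= M + 1,
             q.1 = M + 1 /\ - 2%:R <= q.2 <= p.2,
             q.2 = - 2%:R /\ -1 <= q.1 <= M + 1
           | q.1 = -1 /\ - 2%:R <= q.2 <= -1]
  end.

Lemma between_le (a b c : R) : a <= b -> between a b c \/ between b a c -> a <= c <= b.
Proof. by move=> ab [] [] [c1 c2]; apply/andP; split; lra. Qed.

Lemma on_root_line M i p q : in_box M p ->
  on_polyline (p :: rcons (root_bends M i p) root_point) q \/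
  on_polyline (root_point :: rcons (rev (root_bends M i p)) p) q ->
  root_line M i p q.
Proof.
case=> p1 p2 p3 p4; case: (Z4P i) => ->; rewrite /root_line /root_bends /rev /= => -[].
all: first [move/on_polyline5 => -[] | move/on_polyline3 => -[]].
all: move/on_segment_box=> /= [b1 b2].
all: let tac := (split; [by apply: between_eq |
  by apply: between_le; [lra | first [by left | by right]]]) in
  first [ solve [constructor 1; tac] | solve [constructor 2; tac]
        | solve [constructor 3; tac] | solve [constructor 4; tac]].
Qed.

Lemma root_line_box M i p q : in_box M p -> on_side M i p -> in_box M q ->
  root_line M i p q -> q = p.
Proof.
case: p q => p1 p2 [q1 q2] [/= ? ? ? ?] + [/= ? ? ? ?].
case: (Z4P i) => ->; rewrite /on_side /root_line /= => side H;
  split_hyps; move: H0 => /andP[? ?]; congr pair; lra.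
Qed.

(** The second alternative covers parallel root-edges, whose common end lies on two sides of the
    box; [root_line_box] then identifies the point. *)
Lemma root_line_meet M i j p w q : in_box M p -> on_side M i p ->
  in_box M w -> on_side M j w -> i != j ->
  root_line M i p q -> root_line M j w q -> q = root_point \/ in_box M q.
Proof.
wlog ltij : i j p w / (i < j)%N => [th bp sp bw sw ne lp lw|].
  case: (ltngtP i j) => [lt|lt|/val_inj eq]; last by rewrite eq eqxx in ne.
    exact: th lt bp sp bw sw ne lp lw.
  by rewrite eq_sym in ne; apply: th lt bw sw bp sp ne lw lp.
case: p q w ltij => p1 p2 [q1 q2] [w1 w2] + [/= ? ? ? ?] + [/= ? ? ? ?].
case: (Z4P i) => ->; case: (Z4P j) => -> //;
  rewrite /on_side /root_line /= => _ ? ? _ H H'; split_hyps;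
  repeat match goal with h : is_true (_ && _) |- _ => move: h => /andP[? ?] end;
  first [ exfalso; lra | left; congr pair; lra | right; split => /=; lra ].
Qed.

Lemma root_bends_polyline M i p : in_box M p -> on_side M i p ->
  (orthogonal_polyline (p :: rcons (root_bends M i p) root_point) /\
   simple_polyline (p :: rcons (root_bends M i p) root_point)) /\
  (orthogonal_polyline (root_point :: rcons (rev (root_bends M i p)) p) /\
   simple_polyline (root_point :: rcons (rev (root_bends M i p)) p)).
Proof.
case=> p1 p2 p3 p4.
have long k1 k2 k3 k4 (a b c d f : point R) :
    axis k1 a b -> axis k2 b c -> axis k3 c d -> axis k4 d f ->
    [&& odd k1 != odd k2, odd k2 != odd k3 & odd k3 != odd k4] ->
    (forall r, on_segment (a, b) r -> on_segment (c, d) r -> False) ->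
    (forall r, on_segment (a, b) r -> on_segment (d, f) r -> False) ->
    (forall r, on_segment (b, c) r -> on_segment (d, f) r -> False) ->
  (orthogonal_polyline [:: a; b; c; d; f] /\ simple_polyline [:: a; b; c; d; f]) /\
  (orthogonal_polyline [:: f; d; c; b; a] /\ simple_polyline [:: f; d; c; b; a]).
  move=> ab bc cd df par H1 H2 H3; have /and3P[q1 q2 q3] := par.
  have [ba cb dc fd] := And4 (axis_sym ab) (axis_sym bc) (axis_sym cd) (axis_sym df).
  have par' : [&& odd k4 != odd k3, odd k3 != odd k2 & odd k2 != odd k1].
    by rewrite eq_sym q3 (eq_sym (odd k3) (odd k2)) q2 eq_sym q1.
  have /and3P[q1' q2' q3'] := par'.
  split; split.
  - exact: orthogonal5 ab bc cd df par.
  - apply: simple_polyline5 => //= r; [exact: axis_meet ab bc q1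
      | exact: axis_meet bc cd q2 | exact: axis_meet cd df q3].
  - exact: orthogonal5 fd dc cb ba par'.
  - apply: simple_polyline5 => //= r; [exact: axis_meet fd dc q1'
      | exact: axis_meet dc cb q2' | exact: axis_meet cb ba q3' | ..];
    by move=> /on_segment_sym s /on_segment_sym s'; eauto.
have short k1 k2 (a b c : point R) : axis k1 a b -> axis k2 b c -> odd k1 != odd k2 ->
  (orthogonal_polyline [:: a; b; c] /\ simple_polyline [:: a; b; c]) /\
  (orthogonal_polyline [:: c; b; a] /\ simple_polyline [:: c; b; a]).
  move=> ab bc par; split; first exact: elbow_polyline ab bc par.
  by apply: elbow_polyline (axis_sym bc) (axis_sym ab) _; rewrite eq_sym.
case: (Z4P i) => ->; rewrite /on_side /root_bends /rev /= => side.
(* The four colors are the directions of the successive segments from the box to the root. *)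
- apply: (long 0 1 2%:R 3%:R) => //; first [ by left; apply/pointsE => /=; split=> //; lra
    | by move=> r /on_segment_box[/= r1 r2] /on_segment_box[/= r3 r4];
        unfold between in *; split_hyps; lra ].
- by apply: (short 1 2%:R) => //; left; apply/pointsE => /=; split=> //; lra.
- by apply: (short 2%:R 1) => //; left; apply/pointsE => /=; split=> //; lra.
- apply: (long 3%:R 2%:R 1 0) => //; first [ by left; apply/pointsE => /=; split=> //; lra
    | by move=> r /on_segment_box[/= r1 r2] /on_segment_box[/= r3 r4];
        unfold between in *; split_hyps; lra ].
Qed.

Lemma root_bends_leave M i p : in_box M p -> on_side M i p ->
  points i p (head root_point (root_bends M i p)).
Proof.
case=> p1 p2 p3 p4; case: (Z4P i) => ->; rewrite /on_side /= => side;
  by apply/pointsE => /=; split=> //; lra.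
Qed.

(** The root-edges are counterclockwise in [i], whereas directions decrease counterclockwise; hence
    [1 - i], root-edge 1 leaving the root to the right. *)
Lemma root_bends_arrive M i p : in_box M p ->
  points (1 - i) root_point (head p (rev (root_bends M i p))).
Proof.
case=> p1 p2 p3 p4; case: (Z4P i) => ->; rewrite /on_side /rev /=;
  by apply/pointsE => /=; split=> //; lra.
Qed.

End PlaneGeometry.

(** * Arithmetic of colors modulo 4 *)

Ltac Z4 i := by case: (Z4P i) => ->.

Lemma odd_add1 (i : 'Z_4) : odd (i + 1)%R = ~~ odd i. Proof. Z4 i. Qed.
Lemma odd_sub1 (i : 'Z_4) : odd (i - 1)%R = ~~ odd i. Proof. Z4 i. Qed.
Lemma odd_add2 (i : 'Z_4) : odd (i + 2%:R)%R = odd i. Proof. Z4 i. Qed.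
Lemma add1_neq (i : 'Z_4) : i + 1 != i. Proof. Z4 i. Qed.
Lemma add2_neq (i : 'Z_4) : i + 2%:R != i. Proof. Z4 i. Qed.
Lemma add4_Z4 (i : 'Z_4) : i + 4%:R = i. Proof. by apply/eqP; Z4 i. Qed.
Lemma add3_add1 (i : 'Z_4) : i + 3%:R + 1 = i. Proof. by apply/eqP; Z4 i. Qed.
Lemma add2_add1 (i : 'Z_4) : i + 2%:R + 1 = i + 3%:R. Proof. by apply/eqP; Z4 i. Qed.
Lemma add2_add2 (i : 'Z_4) : i + 2%:R + 2%:R = i. Proof. by apply/eqP; Z4 i. Qed.
Lemma sub1_add2 (i : 'Z_4) : i - 1 + 2%:R = i + 1. Proof. by apply/eqP; Z4 i. Qed.
Lemma add2_sub1 (i : 'Z_4) : i + 2%:R - 1 = i - 1 + 2%:R. Proof. by apply/eqP; Z4 i. Qed.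
Lemma sub1_add3 (i : 'Z_4) : i - 1 = i + 3%:R. Proof. by apply/eqP; Z4 i. Qed.

Lemma odd_neqP (i j : 'Z_4) : (odd i != odd j) = (j == i + 1) || (j == i - 1).
Proof. by case: (Z4P i) => ->; Z4 j. Qed.
Lemma odd_eqP (i j : 'Z_4) : (odd i == odd j) = (j == i) || (j == i + 2%:R).
Proof. by case: (Z4P i) => ->; Z4 j. Qed.

(** * Orbits, faces and edges of plane maps *)

Section Permutations.
Variables (D : finType) (s : {perm D}).

Lemma porbit_closed (P : pred D) x y :
  (forall z, P z -> P (s z)) -> P x -> y \in porbit s x -> P y.
Proof.
by move=> Ps Px /porbitP[n ->]; rewrite permX; elim: n => //= n; apply: Ps.
Qed.

Lemma porbit_iterP x y :
  reflect (exists2 k, (k < #|porbit s x|)%N & y = iter k s x) (y \in porbit s x).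
Proof.
rewrite porbit_traject; apply: (iffP trajectP) => [[k ? ->]|[k ? ->]];
  by exists k.
Qed.

Lemma iter_porbit_inj x j k : (j < #|porbit s x|)%N -> (k < #|porbit s x|)%N ->
  iter j s x = iter k s x -> j = k.
Proof.
move=> ltj ltk /eqP.
rewrite -(nth_traject s ltj x) -(nth_traject s ltk x).
by rewrite nth_uniq ?size_traject ?uniq_traject_porbit // => /eqP.
Qed.

Lemma mem_iter_porbit k x : iter k s x \in porbit s x.
Proof. by rewrite -permX mem_porbit. Qed.

Lemma porbit_step x : porbit s (s x) = porbit s x.
Proof. by apply/eqP; rewrite eq_porbit_mem; apply: (mem_iter_porbit 1%N). Qed.

Lemma porbit_eq x y : y \in porbit s x -> porbit s y = porbit s x.
Proof. by move=> ?; apply/eqP; rewrite eq_porbit_mem. Qed.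

Lemma porbit_partition : partition (porbits s) [set: D].
Proof.
rewrite /partition; apply/and3P; split.
- apply/eqP/setP=> x; rewrite inE; apply/bigcupP.
  by exists (porbit s x); rewrite ?porbit_id // imset_f.
- apply/trivIsetP=> _ _ /imsetP[x _ ->] /imsetP[y _ ->] neq.
  apply/pred0P=> z /=; apply/andP=> -[zx zy]; case/eqP: neq.
  by rewrite -(porbit_eq zx) (porbit_eq zy).
- apply/imsetP=> -[x _ /setP/(_ x)]; by rewrite inE porbit_id.
Qed.

(** Written as a sum along the contour, the indicator of a face can be cut at the turns into
    stretches that are tree paths. *)
Lemma porbit_addb x m :
  \big[addb/false]_(0 <= k < #|porbit s x|) (m == iter k s x) = (m \in porbit s x).
Proof.
rewrite porbit_traject; set N := #|_|; have := uniq_traject_porbit s x.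
rewrite -/N; elim: N => [|N IH]; first by rewrite big_geq.
rewrite trajectSr rcons_uniq big_nat_recr //= mem_rcons inE => /andP[nin /IH ->].
by case: eqP nin => [->|_ _] /=; [move/negPf -> | rewrite addbF].
Qed.

End Permutations.

Section PlaneMaps.
Variable G : planeMap.
Implicit Types (d : dart G) (v : vertex G).

Lemma tgt_opp d : tgt (opp G d) = org d. Proof. by rewrite /tgt oppK. Qed.
Lemma org_ccwE d : org (ccw G d) = org d.
Proof. by apply/esym/eqP; rewrite org_ccw; apply: (mem_iter_porbit _ 1%N). Qed.
Lemma fnextE d : fnext G d = ccw G (opp G d). Proof. by rewrite permM. Qed.
Lemma org_fnext d : org (fnext G d) = tgt d. Proof. by rewrite fnextE org_ccwE. Qed.
Lemma ccwE d : ccw G d = fnext G (opp G d). Proof. by rewrite fnextE oppK. Qed.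
Lemma face_fnext d : face (fnext G d) = face d. Proof. exact: porbit_step. Qed.
Lemma face_id d : d \in face d. Proof. exact: porbit_id. Qed.
Lemma face_mem d d' : (d' \in face d) = (face d' == face d).
Proof. by rewrite eq_porbit_mem. Qed.
Lemma face_faces d : face d \in faces G. Proof. exact: imset_f. Qed.
Lemma facesP f : f \in faces G -> exists d, f = face d.
Proof. by case/imsetP=> d _ ->; exists d. Qed.
Lemma mem_faces f d : f \in faces G -> (d \in f) = (face d == f).
Proof. by case/facesP=> d' ->; rewrite face_mem. Qed.

(** Since [ccw] is [fnext] after [opp], the property spreads around each vertex, and connectedness
    of the map does the rest. With a property of faces, this is connectedness of the dual graph. *)
Lemma dart_ind (P : pred (dart G)) d0 :
  (forall d, P d -> P (opp G d)) -> (forall d, P d -> P (fnext G d)) ->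
  P d0 -> forall d, P d.
Proof.
move=> Po Pf P0.
have Pc d d' : P d -> org d = org d' -> P d'.
  move=> Pd /eqP; rewrite org_ccw; apply: porbit_closed => // z Pz.
  by rewrite ccwE; apply/Pf/Po.
move=> d; have /connectP[p] := map_connected (org d0) (org d).
elim: p d0 P0 => [|u p IH] d0 P0 /=; first by move=> _ /esym; apply: Pc.
case/andP=> /existsP[d1 /and3P[_ /eqP o1 /eqP t1]] pp eqd.
apply: (IH (opp G d1)); rewrite ?t1 //; apply: Po.
by apply: Pc P0 _; rewrite o1.
Qed.

Lemma edgeE d : edge d = [set d; opp G d].
Proof.
apply/eqP; rewrite eq_sym eqEcard; apply/andP; split.
  by apply/subsetP=> z; rewrite !inE => /orP[]/eqP->;
    [exact: porbit_id | exact: (mem_iter_porbit _ 1%N)].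
rewrite cards2 eq_sym opp_neq /=.
suff : edge d \subset [set d; opp G d].
  by move/subset_leq_card; rewrite cards2 eq_sym opp_neq.
apply/subsetP=> z; apply: (porbit_closed (P := [in [set d; opp G d]])).
  by move=> y; rewrite !inE => /orP[]/eqP->; rewrite ?oppK eqxx ?orbT.
by rewrite !inE eqxx.
Qed.

Lemma edge_eq d d' : (edge d == edge d') = (d == d') || (d == opp G d').
Proof.
by have := eq_porbit_mem (opp G) d d'; rewrite -/(edge d) -/(edge d') => ->;
  rewrite edgeE !inE.
Qed.

Lemma card_darts : #|dart G| = (#|edges G| * 2)%N.
Proof.
rewrite -cardsT; apply: card_uniform_partition (porbit_partition _).
move=> _ /imsetP[d _ ->]; rewrite -/(edge d) edgeE cards2.
by rewrite eq_sym opp_neq.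
Qed.

Lemma card_darts_degree : #|dart G| = (\sum_(v : vertex G) degree v)%N.
Proof.
rewrite -sum1_card (partition_big (@org G) predT) //=.
by apply: eq_bigr => v _; rewrite /degree -sum1_card; apply: eq_bigl => d; rewrite inE.
Qed.

End PlaneMaps.

(** * Colors and turns of a decomposition *)

Section Decomposition.
Variables (G : planeMap) (root : vertex G).
Variables (e : 'Z_4 -> dart G) (T : 'Z_4 -> {set dart G}).
Hypothesis regular4 : forall v : vertex G, degree v = 4%N.
Hypothesis root_e : root_edges root e.
Hypothesis T_regular : regular_decomposition root e T.
Hypothesis T_even : even_decomposition root T.
Implicit Types (d : dart G) (v : vertex G) (i c : 'Z_4).

(** The default is taken only at darts leaving the root, which belong to no tree. *)
Definition color d : 'Z_4 := odflt 0 [pick i | d \in T i].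

Lemma T_spanning i : spanning_tree root (T i). Proof. by case: T_regular. Qed.
Lemma org_e i : org (e i) = root. Proof. by case: (root_e i). Qed.
Lemma ccw_e i : ccw G (e i) = e (i + 1). Proof. by case: (root_e i). Qed.
Lemma org_T d i : d \in T i -> org d != root.
Proof. by case: (T_spanning i) => + _ _; apply. Qed.
Lemma tgt_e i : tgt (e i) != root.
Proof. by rewrite -(org_e i) /tgt loopless. Qed.
Lemma e_T i k : (e i \in T k) = false.
Proof. by apply/negP=> /org_T; rewrite org_e eqxx. Qed.
Lemma opp_e_T i k : (opp G (e i) \in T k) = (k == i).
Proof. by case: T_regular => _ _ /(_ i k)[]. Qed.

Lemma root_dartP d : org d = root -> exists i, d = e i.
Proof.
move/eqP; rewrite eq_sym -(org_e 0) org_ccw => din.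
suff /existsP[i /eqP->] : [exists i, d == e i] by exists i.
apply: (@porbit_closed _ (ccw G) (fun z => [exists i, z == e i]) (e 0)) din.
  2: by apply/existsP; exists 0.
move=> z.
by case/existsP=> i /eqP->; rewrite ccw_e; apply/existsP; exists (i + 1).
Qed.

(** The root-edges exhaust the four darts at the root, so four indices must give four different
    darts. *)
Lemma e_inj : injective e.
Proof.
have card4 : #|[set e i | i : 'Z_4]| = #|'Z_4|.
  transitivity (degree root); last by rewrite regular4 card_ord.
  apply: eq_card => d; rewrite inE.
  apply/imsetP/eqP => [[i _ ->]|/root_dartP[i ->]]; [exact: org_e | by exists i].
by move=> i j; apply: (imset_injP (introT eqP card4)).
Qed.

Lemma nonrootN d : nonroot_dart root (opp G d) = nonroot_dart root d.
Proof. by rewrite /nonroot_dart tgt_opp andbC. Qed.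

Lemma nonroot_org d : nonroot_dart root d -> org d != root.
Proof. by case/andP. Qed.

Lemma nonroot_tgt d : nonroot_dart root d -> tgt d != root.
Proof. by case/andP. Qed.

Lemma rootarcP d : tgt d = root -> exists i, d = opp G (e i).
Proof. by case/root_dartP => i eq; exists i; rewrite -eq oppK. Qed.

Lemma in_T d k : org d != root -> (d \in T k) = (k == color d).
Proof.
move=> nr; rewrite /color; have [t_root|t_nroot] := eqVneq (tgt d) root.
  have [i ->] := rootarcP t_root; rewrite opp_e_T.
  by case: pickP => [j|/(_ i)]; rewrite opp_e_T ?eqxx //= => /eqP->.
have [_ /(_ d)+ _ _] := T_regular; rewrite /nonroot_dart nr => /(_ t_nroot).
case=> i [j [_ ij]].
have {}ij c : (d \in T c) = (c == i).
  by case: (ij c); case: (d \in _) => <-.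
by rewrite ij; case: pickP => [c|/(_ i)]; rewrite ij ?eqxx //= => /eqP->.
Qed.

Lemma color_T d k : d \in T k -> color d = k.
Proof. by move=> dT; apply/esym/eqP; rewrite -in_T // (org_T dT). Qed.

Lemma T_color d : org d != root -> d \in T (color d).
Proof. by move=> nr; rewrite in_T. Qed.

Lemma color_opp_e i : color (opp G (e i)) = i.
Proof. by apply: color_T; rewrite opp_e_T. Qed.

Lemma arc_at v c : v != root -> exists2 d, d \in T c & org d = v.
Proof.
by move=> nr; case: (T_spanning c) => _ /(_ v nr)[d [[dT ov] _]] _; exists d.
Qed.

Lemma arc_uniq d d' : org d != root -> org d = org d' -> color d = color d' ->
  d = d'.
Proof.
move=> nr oo cc; case: (T_spanning (color d)) => _ /(_ _ nr)[d0 [_ u]] _.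
rewrite -(u d) ?T_color //; apply: u.
  by rewrite cc T_color -?oo.
Qed.

Lemma color_ccw d : org d != root -> color (ccw G d) = color d - 1.
Proof.
move=> nr; have [d' d'T oo] := arc_at (color d - 1) nr.
have [_ _ _ /(_ (color d - 1) d' d d'T)] := T_regular.
by rewrite subrK => <- //; [exact: color_T | exact: T_color].
Qed.

Lemma color_fnext d : tgt d != root -> color (fnext G d) = color (opp G d) - 1.
Proof. by move=> nr; rewrite fnextE color_ccw. Qed.

Lemma color_odd d : nonroot_dart root d -> odd (color d) != odd (color (opp G d)).
Proof.
move=> nd; apply: (T_even nd (T_color (nonroot_org nd))).
exact: T_color (nonroot_tgt nd).
Qed.

(* A dart is a turn when the contour of the face on its right switches color
   just after it. *)
Definition turn d : bool :=
  nonroot_dart root d && (color (opp G d) == color d - 1).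

Lemma turnN d : nonroot_dart root d -> turn (opp G d) = ~~ turn d.
Proof.
move=> nd; rewrite /turn nonrootN nd oppK /=; have := color_odd nd.
by move: (color d) (color (opp G d)) => i j; case: (Z4P i) => ->; Z4 j.
Qed.

Lemma color_turn d : turn d -> color (fnext G d) = color d + 2%:R.
Proof.
case/andP=> /nonroot_tgt nt /eqP c; rewrite color_fnext // c.
by apply/eqP; move: (color d) => i; Z4 i.
Qed.

Lemma opp_noturn d : nonroot_dart root d -> ~~ turn d ->
  color (opp G d) = color d + 1.
Proof.
move=> nd; rewrite /turn nd /=; have := color_odd nd.
rewrite odd_neqP => /orP[/eqP->//|/eqP->]; by rewrite eqxx.
Qed.

Lemma color_noturn d : nonroot_dart root d -> ~~ turn d ->
  color (fnext G d) = color d.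
Proof.
by move=> nd nt; rewrite color_fnext ?opp_noturn ?addrK //; case/andP: nd.
Qed.

(** The form in which acyclicity of the trees is used: a nonempty set of vertices closed under
    taking parents contains the root. *)
Lemma T_closed c (Q : pred (vertex G)) v :
  (forall d, d \in T c -> Q (org d) -> Q (tgt d)) -> Q v -> Q root.
Proof.
move=> QT Qv; have [_ _ /(_ v)/connectP[p]] := T_spanning c.
elim: p v Qv => [|u p IH] v Qv /=; first by move=> _ ->.
case/andP=> /existsP[d /and3P[dT /eqP ov /eqP tu]] pp; apply: IH pp => //.
by rewrite -tu; apply: QT; rewrite ?ov.
Qed.

(** * Counting edges, faces and turns *)

Lemma card_edges : #|edges G| = (2 * #|vertex G|)%N.
Proof.
have := card_darts_degree G; rewrite card_darts.
under eq_bigr do rewrite regular4.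
rewrite sum_nat_const (eq_card (B := vertex G)) //; lia.
Qed.

Lemma card_faces : #|faces G| = (#|vertex G| + 2)%N.
Proof.
have: (#|vertex G| + #|faces G| = #|edges G| + 2)%N := euler G.
rewrite card_edges; lia.
Qed.

Lemma nonroot_darts_compl : ~: [set d | nonroot_dart root d] =
  [set e i | i : 'Z_4] :|: [set opp G (e i) | i : 'Z_4].
Proof.
apply/setP=> d; rewrite !inE /nonroot_dart negb_and !negbK; apply/orP/orP=> -[].
- by move/eqP/root_dartP=> [i ->]; left; apply: imset_f.
- by move/eqP/rootarcP=> [i ->]; right; apply: (imset_f (fun i => opp G (e i))).
- by case/imsetP=> i _ ->; left; rewrite org_e.
- by case/imsetP=> i _ ->; right; rewrite tgt_opp org_e.
Qed.

Lemma card_nonroot_darts :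
  (#|[set d | nonroot_dart root d]| + 8 = 4 * #|vertex G|)%N.
Proof.
have oi : injective (fun i => opp G (e i)) by move=> i j /perm_inj/e_inj.
have dis : [disjoint [set e i | i : 'Z_4] & [set opp G (e i) | i : 'Z_4]].
  apply/pred0P=> d /=; apply/negP=> /andP[/imsetP[i _ ->] /imsetP[j _ eqd]].
  by have := tgt_e j; rewrite /tgt -eqd org_e eqxx.
have cE : #|[set e i | i : 'Z_4]| = 4%N by rewrite (card_imset _ e_inj) card_ord.
have cE' : #|[set opp G (e i) | i : 'Z_4]| = 4%N by rewrite (card_imset _ oi) card_ord.
have := cardsC [set d | nonroot_dart root d]; rewrite nonroot_darts_compl cardsU.
rewrite (disjoint_setI0 dis) cards0 cE cE' card_darts card_edges; lia.
Qed.

Lemma card_turns : (#|[set d | turn d]| + 4 = 2 * #|vertex G|)%N.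
Proof.
have := card_nonroot_darts; set A := [set d | nonroot_dart _ _].
set B := [set d | turn d].
have BA : B \subset A by apply/subsetP=> d; rewrite !inE => /andP[].
have AB : A :\: B = opp G @: B.
  apply/setP=> d; rewrite !inE; apply/andP/imsetP => [[nt nd]|[d' + ->]].
    by exists (opp G d); rewrite ?oppK // inE turnN.
  by rewrite inE => t; have [nd _] := andP t; rewrite turnN // t nonrootN.
have := cardsID B A; rewrite AB (setIidPr BA) (card_imset _ (@perm_inj _ _)); lia.
Qed.

Lemma nonroot_face_dart f d : f \in nonroot_faces root -> d \in f ->
  nonroot_dart root d.
Proof.
rewrite inE => /andP[ff /forallP fr] df.
have := fr d; have := fr (fnext G d); rewrite df org_fnext.
rewrite mem_faces // face_fnext -mem_faces // df /= => t o.
exact/andP.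
Qed.

Lemma nonroot_faceP d : (forall i, face d != face (e i)) ->
  face d \in nonroot_faces root.
Proof.
move=> ne; rewrite inE face_faces /=; apply/forallP=> d'; apply/implyP.
rewrite face_mem => /eqP fd; apply/eqP=> /root_dartP[i di].
by case/eqP: (ne i); rewrite -di fd.
Qed.

Lemma face_e_root i : face (e i) \notin nonroot_faces root.
Proof.
by apply/negP=> /nonroot_face_dart/(_ (face_id _))/nonroot_org; rewrite org_e eqxx.
Qed.

(** Without a turn the contour has a single color [c], so each of its vertices has its parent in
    [T c] on the contour too; by [T_closed] the root would be on it. *)
Lemma face_turn f : f \in nonroot_faces root -> exists2 d, d \in f & turn d.
Proof.
move=> fn; have [d df] : exists d, d \in f.
  by move: fn; rewrite inE => /andP[/facesP[d ->] _]; exists d; apply: face_id.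
case: (pickP [pred d | (d \in f) && turn d]) => [d' /andP[]|nt].
  by exists d'.
have ff : f \in faces G by move: fn; rewrite inE => /andP[].
have stepf d' : d' \in f -> fnext G d' \in f.
  by rewrite !mem_faces // face_fnext.
have colf d' : d' \in f -> color (fnext G d') = color d'.
  move=> d'f; apply: color_noturn; first exact: nonroot_face_dart d'f.
  by have := nt d'; rewrite /= d'f /= => ->.
have cf d' : d' \in f -> color d' = color d.
  have fd : f = porbit (fnext G) d by move: df; rewrite mem_faces // => /eqP.
  move=> d'f; apply/eqP; have: (d' \in f) && (color d' == color d).
    rewrite fd in d'f; apply: (@porbit_closed _ (fnext G)
      (fun z => (z \in f) && (color z == color d)) d) d'f.
      by move=> z /andP[zf /eqP zc]; rewrite stepf // colf // zc eqxx.
    by rewrite df eqxx.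
  by case/andP.
have /existsP[d' /andP[d'f /eqP]] : [exists d', (d' \in f) && (org d' == root)].
  apply: (@T_closed (color d) (fun v => [exists d', (d' \in f) && (org d' == v)])
    (org d)); last by apply/existsP; exists d; rewrite df eqxx.
  move=> a aT /existsP[d' /andP[d'f /eqP oo]]; apply/existsP.
  exists (fnext G d'); rewrite stepf // org_fnext.
  have nr := nonroot_org (nonroot_face_dart fn d'f).
  by rewrite (arc_uniq nr oo) ?eqxx // cf // (color_T aT).
by have := nonroot_org (nonroot_face_dart fn d'f) => /eqP.
Qed.

Definition turns (f : {set dart G}) := [set d in f | turn d].

(** The color changes only at turns, by 2. After the turn [d] it differs from [color d], and it can
    come back only through a turn of another color. *)
Lemma two_turns f : f \in nonroot_faces root -> (2 <= #|turns f|)%N.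
Proof.
move=> fn; have [d df td] := face_turn fn.
have ff : f \in faces G by move: fn; rewrite inE => /andP[].
have fd : f = porbit (fnext G) d by move: df; rewrite mem_faces // => /eqP.
case: (pickP [pred d' | [&& d' \in f, turn d' & color d' != color d]]).
  move=> d' /and3P[d'f td' cd'].
  have -> : 2%N = #|[set d; d']|.
    by rewrite cards2; have -> : d != d' by apply: contraNneq cd' => ->.
  by apply/subset_leq_card/subsetP=> z; rewrite !inE => /orP[]/eqP->; apply/andP.
move=> nt; have: (d \in f) && (color d != color d); last by rewrite eqxx andbF.
have fdn : porbit (fnext G) (fnext G d) = porbit (fnext G) d by rewrite porbit_step.
have dfn : d \in porbit (fnext G) (fnext G d) by rewrite fdn porbit_id.
apply: (@porbit_closed _ (fnext G)
  (fun z => (z \in f) && (color z != color d)) _ _ _ _ dfn).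
  move=> z /andP[zf cz].
  have -> : fnext G z \in f by rewrite mem_faces // face_fnext -mem_faces.
  rewrite color_noturn //; first exact: nonroot_face_dart zf.
  by have := nt z; rewrite /= zf cz andbT /= => ->.
rewrite mem_faces // face_fnext -mem_faces // df color_turn // add2_neq //.
Qed.

(** There are n + 2 faces, at most four of them at the root, and 2n - 4 turns. The lower bound of
    two turns per nonroot face is therefore attained everywhere, which also forces the four
    root-faces to be distinct. *)
Lemma root_face_count :
  [/\ (#|nonroot_faces root| + 2 = #|vertex G|)%N,
      forall f, f \in nonroot_faces root -> #|turns f| = 2%N,
      forall d, turn d -> face d \in nonroot_faces root
    & injective (fun i => face (e i))].
Proof.
set F := nonroot_faces root; pose E := [set face (e i) | i : 'Z_4].
have cE : (#|E| <= 4)%N by rewrite (leq_trans (leq_imset_card _ _)) ?card_ord.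
have FE : faces G = F :|: E.
  apply/setP=> f; rewrite in_setU; apply/idP/orP => [ff|[]]; first last.
  - by case/imsetP=> i _ ->; apply: face_faces.
  - by rewrite inE => /andP[].
  have [d fd] := facesP ff; case: (boolP [forall i, face d != face (e i)]).
    by move/forallP/nonroot_faceP; rewrite fd; left.
  rewrite negb_forall => /existsP[i]; rewrite negbK => /eqP eqf; right.
  by rewrite fd eqf; apply: imset_f.
have dFE : [disjoint F & E].
  apply/pred0P=> f /=; apply/negP=> /andP[fF /imsetP[i _ fE]].
  by move: fF; rewrite fE; apply/negP/face_e_root.
have cF : (#|F| + #|E| = #|vertex G| + 2)%N.
  by rewrite -card_faces FE cardsU (disjoint_setI0 dFE) cards0 subn0.
have sumt : (#|[set d | turn d]| =
    \sum_(f in F) #|turns f| + \sum_(f in E) #|turns f|)%N.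
  transitivity (\sum_(f in faces G) #|turns f|)%N; last first.
    by rewrite -bigU //=; apply: eq_bigl => f; rewrite FE !inE.
  rewrite -sum1_card (partition_big (@face G) (mem (faces G))) /=; last first.
    by move=> d _; apply: face_faces.
  apply: eq_bigr => f ff; rewrite -sum1_card; apply: eq_bigl => d.
  by rewrite !inE mem_faces // andbC.
have ge2 : (2 * #|F| <= \sum_(f in F) #|turns f|)%N.
  by rewrite mulnC -sum_nat_const; apply: leq_sum => f; apply: two_turns.
have cT := card_turns.
have sE : (\sum_(f in E) #|turns f| = 0)%N by lia.
have sF : (\sum_(f in F) #|turns f| = 2 * #|F|)%N by lia.
have cE4 : #|E| = 4%N by lia.
split.
- lia.
- move=> f fF; apply/eqP; rewrite eqn_leq two_turns // andbT.
  have := sF; rewrite (bigD1 f) //=; set s := bigop _ _ _ => sF'.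
  have : (2 * (#|F| - 1) <= s)%N.
    have -> : (#|F| - 1 = \sum_(g in F | g != f) 1)%N.
      by rewrite -sum1_card (bigD1 f) //= addnC addnK.
    rewrite big_distrr /=; apply: leq_sum => g /andP[gF _]; exact: two_turns.
  have : (0 < #|F|)%N by apply/card_gt0P; exists f.
  move: sF'; move: #|F| #|turns f| s => a b c; lia.
- move=> d td; have := face_faces d; rewrite FE in_setU => /orP[//|fE].
  move/eqP: sE; rewrite sum_nat_eq0 => /forallP/(_ (face d)).
  rewrite fE /= cards_eq0 => /eqP/setP/(_ d).
  by rewrite !inE face_id td.
- have cEZ : #|[set face (e i) | i : 'Z_4]| = #|'Z_4| by rewrite card_ord.
  by move=> i j; apply: (imset_injP (introT eqP cEZ)).
Qed.

Lemma face_nonroot_dart d k : face d \in nonroot_faces root ->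
  nonroot_dart root (iter k (fnext G) d).
Proof. by move/nonroot_face_dart; apply; apply: mem_iter_porbit. Qed.

Lemma iter_face k d : face (iter k (fnext G) d) = face d.
Proof. by elim: k => //= k; rewrite face_fnext. Qed.

(** The last range includes [#|face d|], where the contour is back at [d]: the arc [d] closes the
    half of the contour that has its color. *)
Lemma turn_seq d : turn d -> exists m : nat,
  [/\ (0 < m < #|face d|)%N,
      forall k, (k < #|face d|)%N -> turn (iter k (fnext G) d) = (k \in [:: 0; m]),
      forall k, (0 < k <= m)%N -> color (iter k (fnext G) d) = color d + 2%:R
    & forall k, (m < k <= #|face d|)%N -> color (iter k (fnext G) d) = color d].
Proof.
move=> td; have [_ two turnF _] := root_face_count.
have fF := turnF _ td; have /cards2P[d1 [d2 [d12 td12]]] : #|turns (face d)| == 2%N.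
  by rewrite two.
have din : d \in turns (face d) by rewrite inE face_id td.
have [d' [dd' eqd']] : exists d', d != d' /\ turns (face d) = [set d; d'].
  move: din; rewrite td12 !inE => /orP[]/eqP ->; first by exists d2.
  by exists d1; rewrite eq_sym d12 setUC.
have : d' \in turns (face d) by rewrite eqd' !inE eqxx orbT.
rewrite inE => /andP[/porbit_iterP[m ltm eqm] td'].
have tk k : (k < #|face d|)%N -> turn (iter k (fnext G) d) = (k \in [:: 0%N; m]).
  move=> ltk; have Npos : (0 < #|face d|)%N by apply: leq_ltn_trans ltk.
  have := iter_porbit_inj ltk ltm; have := iter_porbit_inj ltk Npos => /= k0 km.
  have : (iter k (fnext G) d \in turns (face d)) = turn (iter k (fnext G) d).
    by rewrite inE (mem_iter_porbit (fnext G)).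
  move=> <-; rewrite eqd' !inE; apply/orP/orP=> -[].
  - by move/eqP/k0->; left.
  - by rewrite {1}eqm => /eqP/km->; right.
  - by move/eqP->; left.
  - by move/eqP->; right; rewrite -eqm.
have m0 : (0 < m)%N by case: m {tk ltm} eqm dd' => // -> /=; rewrite eqxx.
have nd k := face_nonroot_dart k fF.
have colm k : (0 < k <= m)%N -> color (iter k (fnext G) d) = color d + 2%:R.
  elim: k => [//|[|k] IH] /andP[_ lek]; first by rewrite /= color_turn.
  rewrite iterS color_noturn ?IH ?(ltnW lek) //.
  rewrite tk ?(ltn_trans _ ltm) // !inE /=; lia.
exists m; split=> //; first by rewrite m0.
elim=> [//|k IH] /andP[lek leN]; rewrite iterS; move: lek; rewrite ltnS leq_eqVlt.
case/orP=> [/eqP mk|mk].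
  rewrite -mk color_turn; last by rewrite -eqm.
  rewrite colm ?m0 ?leqnn //.
  by rewrite -addrA -natrD add4_Z4.
rewrite color_noturn ?IH ?mk ?(ltnW leN) // tk // !inE; lia.
Qed.

(** * Tree paths and the regions on their left *)

Lemma sub_path_arcs c v d : d \in path_arcs T c v -> d \in T c.
Proof. by rewrite inE => /andP[]. Qed.

Lemma path_arcs_root c : path_arcs T c root = set0.
Proof.
apply/setP=> d; rewrite !inE; apply/negP=> /andP[dT /connectP[p]].
case: p => [|u p] /=; first by move=> _ /eqP; rewrite (negPf (org_T dT)).
case/andP=> /existsP[a /and3P[aT /eqP oa _]].
by move: (org_T aT); rewrite oa eqxx.
Qed.

Lemma connect_step c d w : d \in T c -> org d != w ->
  connect (arc_rel (@org G) (opp G) (T c)) (org d) w =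
  connect (arc_rel (@org G) (opp G) (T c)) (tgt d) w.
Proof.
move=> dT dw; apply/idP/idP; last first.
  apply: connect_trans; apply: connect1; apply/existsP; exists d.
  by rewrite dT !eqxx.
case/connectP=> -[|u p] /=; first by move=> _ /eqP; rewrite eq_sym (negPf dw).
case/andP=> /existsP[a /and3P[aT /eqP oa /eqP ta]] pp ->.
rewrite (arc_uniq (org_T dT) (esym oa)) ?(color_T dT) ?(color_T aT) //.
by rewrite /tgt ta; apply/connectP; exists p.
Qed.

(** Otherwise the vertices from which [org d] is reachable would be closed under parents and contain
    the root, where no path can leave. *)
Lemma path_arcs_tgt c d : d \in T c -> d \notin path_arcs T c (tgt d).
Proof.
move=> dT; rewrite inE dT /=; apply/negP=> td.
have := org_T dT; apply/negP; rewrite negbK.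
have : connect (arc_rel (@org G) (opp G) (T c)) root (org d).
  apply: (@T_closed c (fun v => connect (arc_rel (@org G) (opp G) (T c)) v (org d))
    (tgt d)) => // a aT; case: (eqVneq (org a) (org d)) => [oad _|].
    by rewrite (arc_uniq (org_T aT) oad) ?(color_T dT) ?(color_T aT).
  by move=> ne; rewrite connect_step.
have := path_arcs_root c => /setP/(_ d); rewrite !inE dT /=; case: eqP => // _ -> //.
Qed.

Lemma path_arcs_step c d d' : d \in T c ->
  (d' \in path_arcs T c (org d)) = (d' == d) (+) (d' \in path_arcs T c (tgt d)).
Proof.
move=> dT; case: eqVneq => [->|ne] /=.
  by rewrite (negPf (path_arcs_tgt dT)) inE dT connect0.
rewrite !inE; case d'T : (d' \in T c) => //=; apply: connect_step => //.
apply: contraNneq ne => oo; rewrite (arc_uniq _ oo) ?(org_T dT) //.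
by rewrite (color_T dT) (color_T d'T).
Qed.

(** A stretch of contour inside one tree is the beginning of a tree path. The sum modulo 2 lets
    paths be added as chains; the next lemma does the same for the reversed darts. *)
Lemma path_arcs_cw c x a b d : (a <= b)%N ->
  (forall k, (a <= k < b)%N -> iter k (fnext G) x \in T c) ->
  (d \in path_arcs T c (org (iter a (fnext G) x))) =
  (\big[addb/false]_(a <= k < b) (d == iter k (fnext G) x))
    (+) (d \in path_arcs T c (org (iter b (fnext G) x))).
Proof.
elim: b => [|b IH]; first by rewrite leqn0 => /eqP->; rewrite big_geq.
rewrite leq_eqVlt => /orP[/eqP-> _|]; first by rewrite big_geq.
rewrite ltnS => leab inT; rewrite IH //; last first.
  by move=> k /andP[ak kb]; rewrite inT // ak ltnW.
rewrite big_nat_recr //= -addbA (path_arcs_step _ (inT b _)) ?leab ?leqnn //.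
by rewrite org_fnext.
Qed.

Lemma path_arcs_ccw c x a b d : (a <= b)%N ->
  (forall k, (a <= k < b)%N -> opp G (iter k (fnext G) x) \in T c) ->
  (d \in path_arcs T c (org (iter b (fnext G) x))) =
  (\big[addb/false]_(a <= k < b) (opp G d == iter k (fnext G) x))
    (+) (d \in path_arcs T c (org (iter a (fnext G) x))).
Proof.
elim: b => [|b IH]; first by rewrite leqn0 => /eqP->; rewrite big_geq.
rewrite leq_eqVlt => /orP[/eqP-> _|]; first by rewrite big_geq.
rewrite ltnS => leab inT.
rewrite big_nat_recr //= org_fnext (path_arcs_step _ (inT b _)) ?leab ?leqnn //.
rewrite tgt_opp IH; last 2 first.
- exact: leab.
- by move=> k /andP[ak kb]; rewrite inT // ak ltnW.
by rewrite (can2_eq (oppK (p := G)) (oppK (p := G))) addbA (addbC (_ == _)).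
Qed.

(** * Curves through a vertex and their regions *)

Definition curve i v := path_arcs T i v :|: path_arcs T (i + 2%:R) v.

Definition on_curve i v d :=
  (d \in path_arcs T i v) (+) (opp G d \in path_arcs T i v) (+)
  ((d \in path_arcs T (i + 2%:R) v) (+) (opp G d \in path_arcs T (i + 2%:R) v)).

Lemma T_parity d i j : d \in T i -> opp G d \in T j -> odd i != odd j.
Proof.
move=> dT dT'; apply: (T_even _ dT dT').
by rewrite /nonroot_dart (org_T dT) (org_T dT').
Qed.

(** No two of the four terms of the sum hold together: a dart has one color, and a dart and its
    reverse have colors of different parities. *)
Lemma on_curveE i v d : on_curve i v d = (d \in curve i v) || (opp G d \in curve i v).
Proof.
have par (j k : 'Z_4) : odd j = odd k ->
    (d \in path_arcs T j v) && (opp G d \in path_arcs T k v) = false.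
  move=> jk; apply/negP=> /andP[/sub_path_arcs d1 /sub_path_arcs d2].
  by have := T_parity d1 d2; rewrite jk eqxx.
have same z : (z \in path_arcs T i v) && (z \in path_arcs T (i + 2%:R) v) = false.
  apply/negP=> /andP[/sub_path_arcs/color_T <- /sub_path_arcs/color_T/esym/eqP].
  by rewrite (negPf (add2_neq _)).
have := par i i erefl; have := par i (i + 2%:R) (esym (odd_add2 _)).
have := par (i + 2%:R) i (odd_add2 _); have := par (i + 2%:R) _ erefl.
have := same d; have := same (opp G d); rewrite /on_curve !in_setU.
by do 4!case: (_ \in _).
Qed.

Lemma region_start i v : face (e (i + 1)) \in region e T i v.
Proof. by apply/imsetP; exists (e (i + 1)); rewrite // inE connect0. Qed.

Lemma regionP i v d : reflect (connect
  [rel d d' | (d' == fnext G d) ||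
     [&& d' == opp G d, d \notin curve i v & opp G d \notin curve i v]]
  (e (i + 1)) d) (face d \in region e T i v).
Proof.
apply: (iffP imsetP) => [[d']|con]; last by exists d; rewrite // inE.
rewrite inE => con eqf; apply: connect_trans con _.
have : d \in face d' by rewrite face_mem eqf.
case/porbitP=> k ->; rewrite permX; elim: k => [|k IH]; first exact: connect0.
by apply: connect_trans IH (connect1 _); rewrite /= eqxx.
Qed.

Lemma region_cross i v d : face d \in region e T i v -> ~~ on_curve i v d ->
  face (opp G d) \in region e T i v.
Proof.
rewrite on_curveE negb_or => /regionP con /andP[nd nd']; apply/regionP.
by apply: connect_trans con (connect1 _); rewrite /= eqxx nd nd' orbT.
Qed.

Lemma region_ind i v (Q : pred {set dart G}) : Q (face (e (i + 1))) ->
  (forall d, Q (face d) -> ~~ on_curve i v d -> Q (face (opp G d))) ->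
  forall f, f \in region e T i v -> Q f.
Proof.
move=> Q0 Qc _ /imsetP[d + ->]; rewrite inE -/(curve i v).
case/connectP=> p; elim: p (e _) Q0 => [|d2 p IH] d1 Q1 /=; first by move=> _ ->.
case/andP=> st; apply: IH; case/orP: st => [/eqP->|/and3P[/eqP-> n1 n2]].
  by rewrite face_fnext.
by apply: Qc => //; rewrite on_curveE negb_or n1 n2.
Qed.

(** The faces on the left of the closed curve that goes from the root to [v] against P_i(v) and
    returns along P_(i+2)(v). The boundary modulo 2 cannot tell the two sides apart, so the side is
    recorded separately for each path. *)
Record left_of i v (S : {set {set dart G}}) : Prop := LeftOf {
  left_faces : S \subset faces G;
  left_boundary : forall d, (face d \in S) (+) (face (opp G d) \in S) = on_curve i v d;
  left_out : forall d, d \in path_arcs T i v -> face d \in S;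
  left_in : forall d, d \in path_arcs T (i + 2%:R) v -> face (opp G d) \in S;
  left_region : region e T i v = S
}.

Lemma left_of_step i v w f S : left_of i v S -> f \in faces G -> f \notin S ->
    (forall d, on_curve i w d = on_curve i v d (+) ((d \in f) (+) (opp G d \in f))) ->
    (exists2 d, d \in f & on_curve i v d) ->
    (forall d, d \in path_arcs T i w -> d \in path_arcs T i v \/ d \in f) ->
    (forall d, d \in path_arcs T (i + 2%:R) w ->
       d \in path_arcs T (i + 2%:R) v \/ opp G d \in f) ->
  left_of i w (f |: S).
Proof.
move=> [SF bd out inn reg] ff fS cur [z zf zv] Pi Pi2.
have inS' d : (face d \in f |: S) = (face d \in S) (+) (d \in f).
  rewrite in_setU1 mem_faces //; case: eqVneq => [->|_]; last by rewrite addbF.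
  by rewrite (negPf fS).
have bd' d : (face d \in f |: S) (+) (face (opp G d) \in f |: S) = on_curve i w d.
  by rewrite !inS' cur -bd addbACA.
split=> //.
- by apply/subsetP=> g; rewrite in_setU1 => /orP[/eqP->//|]; apply/subsetP.
- move=> d /Pi[/out|]; first by rewrite in_setU1 => ->; rewrite orbT.
  by rewrite (mem_faces _ ff) in_setU1 => ->.
- move=> d /Pi2[/inn|]; first by rewrite in_setU1 => ->; rewrite orbT.
  by rewrite (mem_faces _ ff) in_setU1 => ->.
have S0 : face (e (i + 1)) \in S by rewrite -reg region_start.
apply/eqP; rewrite eqEsubset; apply/andP; split; apply/subsetP => g.
  apply: (region_ind (Q := fun h => h \in f |: S)); first by rewrite in_setU1 S0 orbT.
  by move=> d /= dS; rewrite -bd' dS /= negbK.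
(* The search made for [v] can be repeated for [w]: each of its steps joins two faces of [S], hence
   crosses no edge of the boundary of [f |: S]. *)
have SR : {subset S <= region e T i w}.
  move=> h; rewrite -{1}reg => hS.
  apply: (proj2 (andP (region_ind (v := v) (i := i)
    (Q := fun h => (h \in S) && (h \in region e T i w)) _ _ hS))).
    by rewrite S0 region_start.
  move=> d /= /andP[dS dR] nc; have: face (opp G d) \in S.
    by move: nc; rewrite -bd dS /= negbK.
  move=> dS'; rewrite dS'; apply: region_cross => //.
  by rewrite -bd' !in_setU1 dS dS' !orbT.
rewrite in_setU1 => /orP[/eqP->|/SR//].
(* The edge [z] of the old curve has [f] on one side and a face of [S] on the other; it is off the
   new curve and lets the search enter [f]. *)
have fz : face z = f by apply/eqP; rewrite -mem_faces.
have zS : face (opp G z) \in S by have := bd z; rewrite zv fz (negPf fS).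
rewrite -fz -(oppK z); apply: region_cross; first exact: SR.
by rewrite -bd' oppK !in_setU1 zS fz eqxx orbT.
Qed.

(** Equal boundaries mean that agreement at one face propagates across every edge; the start face
    settles the choice between a set and its complement. *)
Lemma left_of_uniq i (S S' : {set {set dart G}}) :
  S \subset faces G -> S' \subset faces G ->
  (forall d, (face d \in S) (+) (face (opp G d) \in S) =
             (face d \in S') (+) (face (opp G d) \in S')) ->
  face (e (i + 1)) \in S -> face (e (i + 1)) \in S' -> S = S'.
Proof.
move=> SF SF' bd eS eS'.
have same d : (face d \in S) == (face d \in S').
  apply: (dart_ind (P := fun d => (face d \in S) == (face d \in S')) (d0 := e (i + 1))) d;
    last by rewrite eS eS'.
    by move=> d /eqP eqd; have := bd d; rewrite eqd => /addbI->.
  by move=> d; rewrite face_fnext.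
apply/setP=> f; case ff : (f \in faces G).
  by have [d ->] := facesP ff; apply/eqP.
have notin (Q : {set {set dart G}}) : Q \subset faces G -> (f \in Q) = false.
  by move=> QF; apply: contraFF ff => /(subsetP QF).
by rewrite !notin.
Qed.

(** * Root-faces, where the sweep starts *)

Lemma fnext_opp_e j : fnext G (opp G (e j)) = e (j + 1).
Proof. by rewrite fnextE oppK ccw_e. Qed.

Lemma face_opp_e j : face (opp G (e j)) = face (e (j + 1)).
Proof. by rewrite -fnext_opp_e face_fnext. Qed.

Lemma face_e_inj j l : face (e j) = face (e l) -> j = l.
Proof. by have [_ _ _ inj] := root_face_count; apply: inj. Qed.

(** Having no turn, the contour of a root-face is a path of [T (j - 1)] clockwise and a path of
    [T j] counterclockwise. *)
Lemma root_contour j : let N := #|face (e j)| in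
  [/\ (1 < N)%N, iter N.-1 (fnext G) (e j) = opp G (e (j - 1)),
      forall k, (0 < k < N)%N -> iter k (fnext G) (e j) \in T (j - 1)
    & forall k, (k < N.-1)%N -> opp G (iter k (fnext G) (e j)) \in T j].
Proof.
move=> N; have N0 : (0 < N)%N by apply/card_gt0P; exists (e j); apply: face_id.
pose z k := iter k (fnext G) (e j); rewrite -/(z _).
have zlast : z N.-1 = opp G (e (j - 1)).
  apply: (@perm_inj _ (fnext G)); rewrite fnext_opp_e subrK /z -iterS prednK //.
  exact: iter_porbit.
have zneq : z 0%N <> z N.-1.
  by rewrite zlast /= => eqe; have := tgt_e (j - 1); rewrite /tgt -eqe org_e eqxx.
have N1 : (1 < N)%N by case: (N) N0 zneq => [//|[|//]].
(* A root-edge strictly inside the contour would make two root-faces coincide or repeat a dart. *)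
have nd k : (0 < k < N.-1)%N -> nonroot_dart root (z k).
  move=> /andP[k0 kN]; have ltk : (k < N)%N by lia.
  apply/andP; split; apply/eqP.
    case/root_dartP=> l zl; have jl : j = l.
      by apply: face_e_inj; rewrite -zl /z iter_face.
    have := iter_porbit_inj ltk N0; rewrite -/(z _) zl jl => /(_ erefl); lia.
  case/rootarcP=> l zl; have jl : j = l + 1.
    by apply: face_e_inj; rewrite -face_opp_e -zl /z iter_face.
  have ltN : (N.-1 < N)%N by lia.
  have := iter_porbit_inj ltk ltN.
  by rewrite -!/(z _) zlast zl jl addrK => /(_ erefl); lia.
have nt k : ~~ turn (z k).
  apply: contra (face_e_root j) => tz; have [_ _ turnF _] := root_face_count.
  by rewrite -(iter_face k) turnF.
have orgz k : (0 < k < N)%N -> org (z k) != root.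
  case: k => [//|[|k] kN]; rewrite [z _]iterS org_fnext ?tgt_e //.
  by apply: nonroot_tgt; apply: (nd k.+1); lia.
have colz k : (0 < k < N)%N -> color (z k) = j - 1.
  elim: k => [//|[|k] IH kN]; rewrite [z _]iterS.
    by rewrite color_fnext ?tgt_e // color_opp_e.
  have ndk : nonroot_dart root (z k.+1) by apply: nd; lia.
  by rewrite (color_noturn ndk (nt _)) IH //; lia.
split=> // k kN; first by rewrite in_T ?orgz // colz.
case: k kN => [|k] kN; first by rewrite opp_e_T.
have ndk : nonroot_dart root (z k.+1) by apply: nd; lia.
rewrite in_T; last exact: nonroot_tgt ndk.
by rewrite (opp_noturn ndk (nt _)) colz ?subrK //; lia.
Qed.

Lemma path_from_next_e j d :
  (d \in path_arcs T (j - 1) (tgt (e j))) = (d \in face (e j)) (+) (d == e j).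
Proof.
have [N1 _ inT _] := root_contour j; set N := #|_| in N1 inT.
have := path_arcs_cw d (ltnW N1) inT; rewrite /= org_fnext => ->.
have -> : iter N (fnext G) (e j) = e j by apply: iter_porbit.
rewrite org_e path_arcs_root in_set0 addbF.
rewrite -(porbit_addb (fnext G) (e j) d) -/(face _) -/N.
rewrite [in RHS]big_ltn ?(ltnW N1) //=.
by case: (d == e j); case: (bigop _ _ _).
Qed.

Lemma path_from_prev_e j d : (d \in path_arcs T (j + 1) (tgt (e j))) =
  (opp G d \in face (e (j + 1))) (+) (d == e j).
Proof.
have [N1 zl _ inT] := root_contour (j + 1); set N := #|_| in N1 inT zl.
have := @path_arcs_ccw (j + 1) (e (j + 1)) 0 N.-1 d (leq0n _).
rewrite zl /= org_e addrK path_arcs_root in_set0 addbF => ->; last exact: inT.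
rewrite -(porbit_addb (fnext G) (e (j + 1)) (opp G d)) -/(face _) -/N.
rewrite -(prednK (ltnW N1)) big_nat_recr //= zl addrK.
by rewrite (can_eq (oppK (p := G))) -addbA addbb addbF.
Qed.

Definition first_left i : {set {set dart G}} :=
  [set face (e (i + 1)); face (e (i + 2%:R))].

(** The edge [e (i + 1)] lies on both contours and cancels; what remains are the two tree paths from
    its far end. *)
Lemma left_of_first i : left_of i (tgt (e (i + 1))) (first_left i).
Proof.
set S := first_left i; have e12 : i + 1 + 1 = i + 2%:R by rewrite -addrA.
have inS d : (face d \in S) = (d \in face (e (i + 1))) (+) (d \in face (e (i + 2%:R))).
  rewrite !inE !face_mem; case: eqP => [->|//]; case: eqP => // /face_e_inj/addrI.
  by [].
have P1 d : (d \in path_arcs T i (tgt (e (i + 1)))) =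
    (d \in face (e (i + 1))) (+) (d == e (i + 1)).
  by rewrite -path_from_next_e addrK.
have P2 d : (d \in path_arcs T (i + 2%:R) (tgt (e (i + 1)))) =
    (opp G d \in face (e (i + 2%:R))) (+) (d == e (i + 1)).
  by rewrite -e12 path_from_prev_e.
have bd d : (face d \in S) (+) (face (opp G d) \in S) = on_curve i (tgt (e (i + 1))) d.
  rewrite /on_curve !inS !P1 !P2 oppK.
  by do 6!case: (_ \in _) || case: (_ == _).
split=> //.
- by apply/subsetP=> f; rewrite !inE => /orP[]/eqP->; apply: face_faces.
- move=> d; rewrite P1 in_set2 face_mem.
  by case: (d =P e _) => [->|_]; rewrite ?eqxx // addbF => ->.
- move=> d dP; have := sub_path_arcs dP; move: dP; rewrite P2 in_set2 face_mem.
  case: (d =P e _) => [->|_]; first by rewrite e_T.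
  by rewrite addbF => ->; rewrite orbT.
have s1 : face (e (i + 1)) \in S by rewrite !inE eqxx.
apply/eqP; rewrite eqEsubset; apply/andP; split; apply/subsetP => f.
  apply: (region_ind (Q := fun h => h \in S)) => // d dS.
  by rewrite -bd dS /= negbK.
rewrite !inE => /orP[]/eqP->; first exact: region_start.
rewrite -e12 -face_opp_e; apply: region_cross; first exact: region_start.
by rewrite -bd s1 face_opp_e e12 !inE eqxx orbT.
Qed.

(** * Passing from one turn of a face to the other *)

Lemma turn_colors d m : turn d -> (0 < m < #|face d|)%N ->
    turn (iter m (fnext G) d) ->
  (forall k, (0 < k <= m)%N -> color (iter k (fnext G) d) = color d + 2%:R) /\
  (forall k, (m < k <= #|face d|)%N -> color (iter k (fnext G) d) = color d).
Proof.
move=> td /andP[m0 mN] tm; have [m' [_ tk c1 c2]] := turn_seq td.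
by move: tm m0; rewrite (tk m) // !inE => /orP[]/eqP-> // _.
Qed.

Lemma path_arcs_sub c v w : connect (arc_rel (@org G) (opp G) (T c)) v w ->
  {subset path_arcs T c w <= path_arcs T c v}.
Proof.
move=> vw d; rewrite !inE => /andP[-> wd]; exact: connect_trans vw wd.
Qed.

Lemma connect_cw c x a b : (a <= b)%N ->
  (forall k, (a <= k < b)%N -> iter k (fnext G) x \in T c) ->
  connect (arc_rel (@org G) (opp G) (T c))
    (org (iter a (fnext G) x)) (org (iter b (fnext G) x)).
Proof.
elim: b => [|b IH]; first by rewrite leqn0 => /eqP->; rewrite connect0.
rewrite leq_eqVlt => /orP[/eqP-> _|]; first exact: connect0.
rewrite ltnS => leab inT; apply: connect_trans (IH _ _) (connect1 _) => //.
  by move=> k /andP[ak kb]; rewrite inT // ak ltnW.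
apply/existsP; exists (iter b (fnext G) x).
by rewrite inT ?leab //= org_fnext !eqxx.
Qed.

Lemma connect_ccw c x a b : (a <= b)%N ->
  (forall k, (a <= k < b)%N -> opp G (iter k (fnext G) x) \in T c) ->
  connect (arc_rel (@org G) (opp G) (T c))
    (org (iter b (fnext G) x)) (org (iter a (fnext G) x)).
Proof.
elim: b => [|b IH]; first by rewrite leqn0 => /eqP->; rewrite connect0.
rewrite leq_eqVlt => /orP[/eqP-> _|]; first exact: connect0.
rewrite ltnS => leab inT; apply: connect_trans (connect1 _) (IH _ _) => //.
  apply/existsP; exists (opp G (iter b (fnext G) x)).
  by rewrite inT ?leab //= oppK org_fnext !eqxx.
by move=> k /andP[ak kb]; rewrite inT // ak ltnW.
Qed.

Lemma addb_iter_face x d a b :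
  \big[addb/false]_(a <= k < b) (d == iter k (fnext G) x) -> d \in face x.
Proof.
apply: contraLR => nd; rewrite big1 // => k _; apply: contraNF nd => /eqP->.
exact: mem_iter_porbit.
Qed.

Lemma face_addb1 x d :
  \big[addb/false]_(1 <= k < #|face x|.+1) (d == iter k (fnext G) x) = (d \in face x).
Proof.
have N0 : (0 < #|face x|)%N by apply/card_gt0P; exists x; apply: face_id.
rewrite -[RHS](porbit_addb (fnext G)) -/(face x) big_nat_recr //= [in RHS]big_ltn //=.
have -> : iter #|face x| (fnext G) x = x by apply: iter_porbit.
exact: addbC.
Qed.

Lemma mem_path_arcs c d : d \in T c -> d \in path_arcs T c (org d).
Proof. by move=> dT; rewrite inE dT connect0. Qed.

Section TurnFace.
Variables (d : dart G) (m : nat).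
Hypotheses (td : turn d) (mN : (0 < m < #|face d|)%N)
  (tm : turn (iter m (fnext G) d)).

Let z k := iter k (fnext G) d.
Let N := #|face d|.
Let nd k : nonroot_dart root (z k).
Proof. by have [_ _ turnF _] := root_face_count; apply/face_nonroot_dart/turnF. Qed.
Let zN : z N = d. Proof. exact: iter_porbit. Qed.

(** With v and w the heads of the two turns, one half of the contour is the beginning of P_(i+2)(v),
    leading to w, and the other half is the beginning of P_i(w), leading back to v. So the two
    curves differ exactly by the contour. *)
Lemma left_of_turn_cw S : left_of (color d) (tgt d) S ->
  face d \notin S /\ left_of (color d) (tgt (z m)) (face d |: S).
Proof.
set i := color d; set v := tgt d; set w := tgt _; move=> good.
have [c1 c2] := turn_colors td mN tm.
have in1 k : (1 <= k < m.+1)%N -> z k \in T (i + 2%:R).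
  by move=> km; rewrite in_T ?(nonroot_org (nd k)) // c1.
have in2 k : (m.+1 <= k < N.+1)%N -> z k \in T i.
  by move=> km; rewrite in_T ?(nonroot_org (nd k)) // c2.
have m1 : (0 < m.+1)%N by []. have m1N : (m.+1 <= N.+1)%N by lia.
have orgw : org (z m.+1) = w by rewrite [z _]iterS org_fnext.
have orgv : org (z 1%N) = v by rewrite [z _]iterS org_fnext.
have orgv' : org (z N.+1) = v by rewrite [z _]iterS -/(z N) zN org_fnext.
have E1 x := path_arcs_cw x m1 in1; have E2 x := path_arcs_cw x m1N in2.
have := connect_cw m1 in1; have := connect_cw m1N in2.
rewrite -!/(z _) orgv orgv' orgw => con2 con1.
have EF x := face_addb1 d x.
rewrite -/N in EF.
have EN x : \big[addb/false]_(1 <= k < N.+1) (x == z k) =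
    (\big[addb/false]_(1 <= k < m.+1) (x == z k)) (+)
    (\big[addb/false]_(m.+1 <= k < N.+1) (x == z k)).
  by rewrite -big_cat_nat.
have z1P : z 1%N \in path_arcs T (i + 2%:R) v.
  by rewrite -orgv; apply/mem_path_arcs/in1; lia.
have z1c : on_curve i v (z 1%N) by rewrite on_curveE in_setU z1P orbT.
(* P_(i+2)(v) starts with [z 1]: [S] contains the face on its left, hence not the one on its right,
   which is [face d]. *)
have fS : face d \notin S.
  have := left_boundary good (z 1%N); rewrite (left_in good z1P) z1c /=.
  by rewrite addbT [face _]face_fnext.
split=> //; apply: left_of_step good _ fS _ _ _ _; first exact: face_faces.
- move=> x; rewrite /on_curve -!EF !EN.
  have := E1 x; have := E2 x; have := E1 (opp G x); have := E2 (opp G x).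
  rewrite -!/(z _) orgv orgv' orgw => -> -> -> ->.
  by do !case: (bigop _ _ _); do !case: (_ \in _).
- by exists (z 1%N) => //; rewrite face_mem [face _]face_fnext.
- move=> x; have := E2 x; rewrite -!/(z _) orgv' orgw => ->.
  case xv: (x \in path_arcs T i v); first by left.
  by rewrite addbF => /addb_iter_face; right.
- by move=> x /(path_arcs_sub con1); left.
Qed.

(** The same exchange counterclockwise, between the tails of the turns: the reversed darts of one
    half begin P_i(v), those of the other half begin P_(i+2)(w). *)
Lemma left_of_turn_ccw i S : i = color d + 1 -> left_of i (org d) S ->
  face d \notin S /\ left_of i (org (z m)) (face d |: S).
Proof.
set v := org d; set w := org _; move=> ci good.
have [c1 c2] := turn_colors td mN tm.
have colo k : color (opp G (z k)) = color (z k.+1) + 1.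
  by rewrite [z k.+1]iterS color_fnext ?subrK ?(nonroot_tgt (nd k)).
have in1 k : (0 <= k < m)%N -> opp G (z k) \in T (i + 2%:R).
  move=> km; rewrite in_T ?(nonroot_tgt (nd k)) // colo c1 // ci.
  by rewrite addrAC.
have in2 k : (m <= k < N)%N -> opp G (z k) \in T i.
  by move=> km; rewrite in_T ?(nonroot_tgt (nd k)) // colo c2 // ci.
have m1N : (m <= N)%N by rewrite /N; lia.
have orgv' : org (z N) = v by rewrite zN.
have E1 x := path_arcs_ccw x (leq0n m) in1; have E2 x := path_arcs_ccw x m1N in2.
have := connect_ccw (leq0n m) in1; have := connect_ccw m1N in2.
rewrite -!/(z _) orgv' -/w => con2 con1.
have EF x := porbit_addb (fnext G) d x.
rewrite -/(face d) -/N in EF.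
have EN x : \big[addb/false]_(0 <= k < N) (x == z k) =
    (\big[addb/false]_(0 <= k < m) (x == z k)) (+)
    (\big[addb/false]_(m <= k < N) (x == z k)).
  by rewrite -big_cat_nat.
have N0 : (0 < N)%N by rewrite /N; lia.
have tlast : tgt (z N.-1) = v by rewrite -org_fnext -[fnext _ _]iterS prednK.
have zlP : opp G (z N.-1) \in path_arcs T i v.
  rewrite -tlast; apply/mem_path_arcs/in2; rewrite /N; lia.
have zlc : on_curve i v (z N.-1) by rewrite on_curveE !in_setU zlP !orbT.
have fS : face d \notin S.
  have := left_boundary good (z N.-1); rewrite (left_out good zlP) zlc.
  by rewrite iter_face addbT => /negbTE; case: (_ \in _).
split=> //; apply: left_of_step good _ fS _ _ _ _; first exact: face_faces.
- move=> x; rewrite /on_curve -!EF !EN.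
  have := E1 x; have := E2 x; have := E1 (opp G x); have := E2 (opp G x).
  rewrite -!/(z _) orgv' oppK -/v -/w => -> -> -> ->.
  by do !case: (bigop _ _ _); do !case: (_ \in _).
- by exists (z N.-1) => //; apply: mem_iter_porbit.
- by move=> x /(path_arcs_sub con2); left.
- move=> x; have := E1 x; rewrite -!/(z _) -/w -/v => ->.
  case xv: (x \in path_arcs T (i + 2%:R) v); first by left.
  by rewrite addbF => /addb_iter_face; right.
Qed.

End TurnFace.

(** * The sweep through all vertices *)

Definition swept i v : nat := #|nonroot_faces root :&: region e T i v|.
Lemma sweptE i v : swept i v = #|nonroot_faces root :&: region e T i v|.
Proof. by []. Qed.
(* Comparing [swept i v] with [swept j w] by unfolding the cardinal blows up. *)
Opaque swept.

Lemma card_setI1 (K : finType) (A B : {set K}) x : x \in A -> x \notin B ->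
  #|A :&: (x |: B)| = #|A :&: B|.+1.
Proof.
move=> xA xB; rewrite setIUr (setIidPr _) ?sub1set // cardsU1 in_setI.
by rewrite (negPf xB) andbF.
Qed.

(** The arc of color [i + 3] at [v] leaves the curve on the side away from [e (i + 1)]. One of its
    two darts is a turn, and the face on the right of that dart is the next one to add. Only the
    neighbor along [e (i + 3)] has no such face. *)
Lemma left_of_next i v S : v != root -> v != tgt (e (i + 3%:R)) ->
  left_of i v S -> exists w f, [/\ w != root, f \in nonroot_faces root,
    f \notin S & left_of i w (f |: S)].
Proof.
move=> vr vl good; have [a aT oa] := arc_at (i + 3%:R) vr.
have nda : nonroot_dart root a.
  rewrite /nonroot_dart (org_T aT) /=; apply/eqP=> /rootarcP[l al].
  move: (color_T aT); rewrite al color_opp_e => li.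
  by case/eqP: vl; rewrite -oa al li.
have [_ _ turnF _] := root_face_count.
case ta : (turn a).
  have [m [mN tk _ _]] := turn_seq ta; have tm : turn (iter m (fnext G) a).
    by rewrite tk ?inE ?eqxx ?orbT //; case/andP: mN.
  have ci : i = color a + 1 by rewrite (color_T aT) add3_add1.
  rewrite -oa in good; have [fS good'] := left_of_turn_ccw ta mN tm ci good.
  exists (org (iter m (fnext G) a)), (face a); split=> //; last exact: turnF.
  by case/andP: tm => /nonroot_org.
have tb : turn (opp G a) by rewrite turnN // ta.
have [m [mN tk _ _]] := turn_seq tb.
have tm : turn (iter m (fnext G) (opp G a)).
  by rewrite tk ?inE ?eqxx ?orbT //; case/andP: mN.
have ci : i = color (opp G a).
  by rewrite opp_noturn ?ta // (color_T aT) add3_add1.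
rewrite -oa -(tgt_opp a) ci in good.
have [fS good'] := left_of_turn_cw tb mN tm good.
exists (tgt (iter m (fnext G) (opp G a))), (face (opp G a)).
rewrite ci; split=> //; last exact: turnF.
by case/andP: tm => /nonroot_tgt.
Qed.

Lemma on_curve_add2 i v d : on_curve (i + 2%:R) v d = on_curve i v d.
Proof. by rewrite /on_curve -addrA -natrD add4_Z4 addbC. Qed.

Lemma compl_boundary (S : {set {set dart G}}) d :
  (face d \in faces G :\: S) (+) (face (opp G d) \in faces G :\: S) =
  (face d \in S) (+) (face (opp G d) \in S).
Proof. by rewrite !in_setD !face_faces !andbT addbN addNb negbK. Qed.

(** For color [i + 2] this vertex is the start of the sweep, with the same curve. Complementing the
    known initial set therefore gives the same boundary, and uniqueness applies. *)
Lemma left_of_last i S : left_of i (tgt (e (i + 3%:R))) S ->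
  S = faces G :\: first_left (i + 2%:R).
Proof.
move=> good; have goodl := left_of_first (i + 2%:R).
have i3 := add2_add1 i.
have i4 := add2_add2 i.
rewrite i3 in goodl.
apply: (left_of_uniq (i := i)); first exact: left_faces good.
- exact: subsetDl.
- move=> d; rewrite compl_boundary (left_boundary good) (left_boundary goodl).
  by rewrite on_curve_add2.
- by rewrite -(left_region good) region_start.
rewrite in_setD face_faces andbT in_set2 i3 i4; apply/norP; split.
  by apply/eqP=> /face_e_inj/addrI.
by apply/eqP=> /face_e_inj/eqP; rewrite (negPf (add1_neq _)).
Qed.

Lemma swept_last i S : left_of i (tgt (e (i + 3%:R))) S ->
  nonroot_faces root :&: S = nonroot_faces root.
Proof.
move/left_of_last ->; apply/setIidPl/subsetP => f fF; rewrite in_setD.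
have -> : f \in faces G by move: fF; rewrite inE => /andP[].
rewrite andbT in_set2; apply/norP; split;
  by apply: contraTneq fF => ->; apply: face_e_root.
Qed.

Lemma sweep_exists i k : (k <= #|nonroot_faces root|)%N -> exists v,
  [/\ v != root, left_of i v (region e T i v) & swept i v = k].
Proof.
suff H : (k <= #|nonroot_faces root|)%N -> exists v S,
    [/\ v != root, left_of i v S & #|nonroot_faces root :&: S| = k].
  by move=> /H[v [S [vr good <-]]]; exists v; rewrite sweptE (left_region good).
elim: k => [_|k IH ltk].
  exists (tgt (e (i + 1))), (first_left i); split; first exact: tgt_e.
    exact: left_of_first.
  apply/eqP; rewrite cards_eq0; apply/eqP/setP => f; rewrite in_setI in_set2 in_set0.
  apply/negP=> /andP[fF /orP[]/eqP fE]; move: fF; rewrite fE;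
    by apply/negP/face_e_root.
have [v [S [vr good cS]]] := IH (ltnW ltk).
have vl : v != tgt (e (i + 3%:R)).
  apply: contraTneq ltk => vl; rewrite vl in good; rewrite -cS (swept_last good).
  by rewrite ltnn.
have [w [f [wr fF fS good']]] := left_of_next vr vl good.
by exists w, (f |: S); split=> //; rewrite card_setI1 // cS.
Qed.

(** The sweep meets one vertex for each value from 0 to the number n - 2 of nonroot faces, hence n -
    1 distinct nonroot vertices, that is, all of them. *)
Lemma sweep i v : v != root ->
  left_of i v (region e T i v) /\
  (forall w, w != root -> swept i w = swept i v -> w = v).
Proof.
set F := nonroot_faces root => vr.
have /fin_all_exists[f fP] : forall k : 'I_(#|F|.+1), exists v,
    [/\ v != root, left_of i v (region e T i v) & swept i v = k].
  by move=> k; apply: sweep_exists; rewrite -ltnS.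
have finj : injective f.
  move=> j k eqf; apply: val_inj; have [_ _ /= <-] := fP j.
  by rewrite eqf; have [_ _ ->] := fP k.
have fall u : u != root -> exists k, u = f k.
  move=> ur; suff /imsetP[k _ ->] : u \in f @: setT by exists k.
  have -> : f @: setT = [set~ root]; last by rewrite !inE.
  apply/eqP; rewrite eqEcard; apply/andP; split.
    by apply/subsetP=> _ /imsetP[k _ ->]; rewrite !inE; have [] := fP k.
  rewrite card_imset // cardsT card_ord cardsC1.
  have [/= <- _ _ _] := root_face_count; rewrite -/F; lia.
have [k ->] := fall v vr; have [_ ? fk] := fP k; split=> // w /fall[l ->].
by have [_ _ ->] := fP l; rewrite fk => /val_inj->.
Qed.

Lemma left_of_region i v : v != root -> left_of i v (region e T i v).
Proof. by case/(sweep i). Qed.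

Lemma swept_inj i v w : v != root -> w != root -> swept i v = swept i w -> v = w.
Proof. by move=> vr /(sweep i)[_]; apply. Qed.

Lemma swept_le i v : (swept i v <= #|nonroot_faces root|)%N.
Proof. by rewrite sweptE; apply/subset_leq_card/subsetIl. Qed.

Lemma region_next i v : v != root -> (swept i v < #|nonroot_faces root|)%N ->
  exists w, [/\ w != root, swept i w = (swept i v).+1 &
    region e T i v \subset region e T i w].
Proof.
move=> vr ltv; have good := left_of_region i vr.
have vl : v != tgt (e (i + 3%:R)).
  apply: contraTneq ltv => vl; rewrite vl in good.
  by rewrite vl sweptE (swept_last good) ltnn.
have [w [f [wr fF fS good']]] := left_of_next vr vl good.
have rw := left_region good'; exists w; split=> //; last by rewrite rw subsetUr.
by rewrite !sweptE rw card_setI1.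
Qed.

(** * The order of the vertices *)

Lemma region_mono i v w : v != root -> w != root ->
  (swept i v <= swept i w)%N -> region e T i v \subset region e T i w.
Proof.
move=> vr wr; move eqk : (swept i w - swept i v)%N => k.
elim: k v vr eqk => [|k IH] v vr eqk le.
  by rewrite (@swept_inj i v w) //; lia.
have lt : (swept i v < #|nonroot_faces root|)%N by have := swept_le i w; lia.
have [u [ur su sub]] := region_next vr lt.
by apply: subset_trans sub (IH _ ur _ _); lia.
Qed.

Lemma swept_lt i v w f : v != root -> w != root ->
  f \in region e T i w -> f \notin region e T i v -> (swept i v < swept i w)%N.
Proof.
move=> vr wr fw; apply: contraR; rewrite -leqNgt => /(region_mono wr vr)/subsetP.
exact.
Qed.

(** The regions for [i] and [i + 2] are complementary, as they have the same boundary. To exclude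
    their being equal, the region for [i] is compared with the last one of its sweep, which misses
    the faces at [e (i + 3)]. *)
Lemma swept_add2 i v : v != root ->
  (swept (i + 2%:R)%R v + swept i v = #|nonroot_faces root|)%N.
Proof.
move=> vr; have good := left_of_region i vr.
have good2 := left_of_region (i + 2%:R) vr.
have i3 := add2_add1 i; have lr := tgt_e (i + 3%:R).
have endr : swept i (tgt (e (i + 3%:R))) = #|nonroot_faces root|.
  by rewrite sweptE (swept_last (left_of_region i lr)).
have eqR : region e T (i + 2%:R) v = faces G :\: region e T i v.
  apply: (left_of_uniq (i := i + 2%:R)).
  - exact: left_faces good2.
  - exact: subsetDl.
  - move=> d; rewrite compl_boundary (left_boundary good) (left_boundary good2).
    exact: on_curve_add2.
  - exact: region_start.
  rewrite i3 in_setD face_faces andbT.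
  have : region e T i v \subset region e T i (tgt (e (i + 3%:R))).
    by apply: region_mono => //; rewrite endr swept_le.
  move/subsetP=> sub'; apply/negP=> /sub'.
  rewrite (left_of_last (left_of_region i lr)) in_setD in_set2 -i3.
  by rewrite eqxx.
rewrite !sweptE eqR setIDA (setIidPl _) //; first by rewrite addnC cardsID.
by apply/subsetP=> f; rewrite inE => /andP[].
Qed.

Lemma swept_add2_le i v w : v != root -> w != root ->
  (swept (i + 2%:R)%R v <= swept (i + 2%:R)%R w)%N = (swept i w <= swept i v)%N.
Proof.
move=> /(swept_add2 i) + /(swept_add2 i).
move: (swept _ v) (swept i v) (swept _ w) (swept i w) => a b c d; lia.
Qed.

Lemma swept_add2_lt i v w : v != root -> w != root ->
  (swept (i + 2%:R)%R v < swept (i + 2%:R)%R w)%N = (swept i w < swept i v)%N.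
Proof. by move=> vr wr; rewrite !ltnNge swept_add2_le. Qed.

(** Membership of an arc in a path becomes a condition on two faces; as the regions are nested, it
    holds on an interval of vertices. *)
Lemma path_arcs_region i v d : v != root -> d \in T i ->
  (d \in path_arcs T i v) =
  (face d \in region e T i v) && (face (opp G d) \notin region e T i v).
Proof.
move=> vr dT; have good := left_of_region i vr.
have bd := left_boundary good d; apply/idP/andP=> [dP|[df df']].
  have fd := left_out good dP; split=> //; move: bd.
  by rewrite fd on_curveE in_setU dP => /negbTE; case: (_ \in _).
move: bd; rewrite df (negPf df') on_curveE !in_setU => /esym.
case/orP=> /orP[]// /sub_path_arcs dP'.
- by have := color_T dT; rewrite (color_T dP') => /eqP; rewrite (negPf (add2_neq _)).
- by have := T_parity dT dP'; rewrite eqxx.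
- by have := T_parity dT dP'; rewrite odd_add2 eqxx.
Qed.

Lemma path_arcs_in_region i v d : v != root -> d \in T (i + 2%:R) -> org d = v ->
  face (opp G d) \in region e T i v /\ face d \notin region e T i v.
Proof.
move=> vr dT dv; have good := left_of_region i vr.
have dP : d \in path_arcs T (i + 2%:R) v by rewrite -dv mem_path_arcs.
have fd := left_in good dP; split=> //; have := left_boundary good d.
by rewrite fd on_curveE in_setU dP orbT addbT => /negbTE; case: (_ \in _).
Qed.

(** The face on the left of [d] separates the two regions: [d] begins P_i at its tail, so that face
    is outside the region there; at the head it is also on the left of the arc of color [i + 2],
    hence inside. *)
Lemma swept_arc_left i d : d \in T i -> opp G d \in T (i + 1) ->
  (swept i (org d) < swept i (tgt d))%N.
Proof.
move=> dT dT'; have ur := org_T dT; have wr := org_T dT'.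
have := mem_path_arcs dT; rewrite path_arcs_region // => /andP[_ nf].
apply: swept_lt nf => //.
have [z zT oz] := arc_at (i + 1 + 1) wr.
have [_ _ _ /(_ (i + 1) _ _ dT' zT (esym oz))] := T_regular.
have i2 : i + 1 + 1 = i + 2%:R by rewrite -addrA.
rewrite ccwE => ->; rewrite face_fnext.
by rewrite i2 in zT; have [] := path_arcs_in_region wr zT oz.
Qed.

Lemma swept_arc_right i d : d \in T i -> opp G d \in T (i - 1) ->
  (swept i (tgt d) < swept i (org d))%N.
Proof.
move=> dT dT'; have ur := org_T dT; have wr := org_T dT'.
have := mem_path_arcs dT; rewrite path_arcs_region // => /andP[fd _].
apply: swept_lt fd _ => //; rewrite -face_fnext.
have [z zT oz] := arc_at (i + 2%:R) wr.
have i1 : i + 2%:R + 1 = i - 1 by rewrite add2_add1 sub1_add3.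
rewrite -i1 in dT'.
have [_ _ _ /(_ (i + 2%:R) _ _ zT dT' oz)] := T_regular.
by rewrite fnextE => <-; have [] := path_arcs_in_region wr zT oz.
Qed.

(** Arcs of color [i] head in direction [i]: color 1 lowers y, color 2 lowers x, and complements
    give the other two. The previous lemmas are applied to the reverse arc, of color [i + 1] or
    [i - 1]. *)
Lemma swept_arc i d : nonroot_dart root d -> d \in T i ->
  (swept (i - 1)%R (tgt d) < swept (i - 1)%R (org d))%N.
Proof.
move=> nd dT; have dT' := T_color (nonroot_tgt nd).
have := color_odd nd; rewrite (color_T dT) odd_neqP => /orP[]/eqP c.
  rewrite c in dT'; have dT2 : opp G (opp G d) \in T (i + 1 - 1) by rewrite oppK addrK.
  have := swept_arc_right dT' dT2; rewrite tgt_opp.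
  have := swept_add2 (i - 1) (nonroot_org nd).
  have := swept_add2 (i - 1) (nonroot_tgt nd).
  rewrite sub1_add2.
  rewrite -/(tgt d); lia.
rewrite c in dT'; have dT2 : opp G (opp G d) \in T (i - 1 + 1) by rewrite oppK subrK.
by have := swept_arc_left dT' dT2; rewrite tgt_opp.
Qed.

Lemma swept_path i v w : v != root -> w != root ->
  connect (arc_rel (@org G) (opp G) (T i)) v w ->
  (swept (i - 1)%R w <= swept (i - 1)%R v)%N.
Proof.
move=> vr wr /connectP[p]; elim: p v vr => [|u p IH] v vr /=; first by move=> _ ->.
case/andP=> /existsP[a /and3P[aT /eqP oa /eqP ta]] pp wl.
have ur : u != root.
  apply: contraNneq wr => ur; move: pp wl; rewrite ur; case: p {IH} => [_ ->//|x p] /=.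
  by case/andP=> /existsP[b /and3P[/org_T + /eqP ob _]]; rewrite ob eqxx.
apply: leq_trans (IH _ ur pp wl) (ltnW _); rewrite -oa -ta; apply: swept_arc => //.
by rewrite /nonroot_dart oa vr /tgt ta.
Qed.

Lemma subtree_interval i d v u w : v != root -> u != root -> w != root ->
    d \in path_arcs T i v -> d \in path_arcs T i w ->
  (swept i v <= swept i u)%N -> (swept i u <= swept i w)%N ->
  d \in path_arcs T i u.
Proof.
move=> vr ur wr dv dw; have dT := sub_path_arcs dv.
move: dv dw; rewrite !path_arcs_region // => /andP[fv _] /andP[_ fw].
move=> /(region_mono vr ur)/subsetP vu /(region_mono ur wr)/subsetP uw.
by rewrite vu //=; apply: contra fw; apply: uw.
Qed.

(* The edge of [d] has color [i] or [i + 2] at its head, and the subtree of [org d]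
   in that tree contains both ends of [d]; subtrees being intervals, it contains
   [org d'] as well. *)
Lemma perpendicular_arcs i j (d d' : dart G) :
  nonroot_dart root d -> nonroot_dart root d' -> org d != org d' ->
  d \in T j -> d' \in T i -> odd i != odd j ->
  (swept i (tgt d) <= swept i (org d') <= swept i (org d))%N ||
  (swept i (org d) <= swept i (org d') <= swept i (tgt d))%N ->
  (swept (i - 1)%R (tgt d') <= swept (i - 1)%R (org d) <= swept (i - 1)%R (org d'))%N ->
  d = opp G d'.
Proof.
move=> nd nd' ne dT d'T par btw /andP[lo hi].
have vr := nonroot_org nd; have wr := nonroot_org nd'.
have v'r := nonroot_tgt nd; have w'r := nonroot_tgt nd'.
have odT := T_color v'r; set c := color (opp G d) in odT.
have ic : (c == i) || (c == i + 2%:R).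
  rewrite -odd_eqP; have := color_odd nd; rewrite (color_T dT) -/c.
  by move: par; case: (odd i); case: (odd j); case: (odd c).
have [a aT oa] := arc_at c vr.
have av : a \in path_arcs T c (org d) by rewrite -oa mem_path_arcs.
have av' : a \in path_arcs T c (tgt d).
  apply: path_arcs_sub av; apply: connect1; apply/existsP; exists (opp G d).
  by rewrite odT oppK !eqxx.
have aw : a \in path_arcs T c (org d').
  case/orP: ic => /eqP ci; rewrite ci in av av' *.
    case/orP: btw => /andP[]; first exact: (subtree_interval v'r wr vr av' av).
    exact: (subtree_interval vr wr v'r av av').
  case/orP: btw => /andP[b1 b2].
    by apply: (subtree_interval vr wr v'r av av'); rewrite swept_add2_le.
  by apply: (subtree_interval v'r wr vr av' av); rewrite swept_add2_le.
have con : connect (arc_rel (@org G) (opp G) (T c)) (org d') (org d).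
  by move: aw; rewrite inE oa => /andP[].
(* If [c] is [i + 2], the path from [org d'] to [org d] runs against the direction of [d'], so
   [org d] could not lie strictly ahead of [org d']. If [c] is [i], the path starts with [d'] and
   only moves further, so [org d] is the head of [d']. *)
case/orP: ic => /eqP ci; last first.
  have := swept_path wr vr con; rewrite ci add2_sub1 swept_add2_le // => hi'.
  case/eqP: ne; apply: (@swept_inj (i - 1)) => //.
  by apply/eqP; rewrite eqn_leq hi hi'.
rewrite ci in con; rewrite (connect_step d'T) 1?eq_sym // in con.
have vw' : org d = tgt d'.
  apply: (@swept_inj (i - 1)) => //; apply/eqP; rewrite eqn_leq lo andbT.
  exact: swept_path w'r vr con.
apply: (arc_uniq vr vw'); have := color_odd nd'; rewrite (color_T d'T) (color_T dT).
move=> par'; have : odd j == odd (color (opp G d')).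
  by move: par par'; case: (odd i); case: (odd j); case: (odd (color _)).
rewrite odd_eqP => /orP[/eqP->//|/eqP k].
(* The case left is that [d] and the reverse of [d'] leave the same vertex in opposite directions;
   then [org d'] cannot be between the ends of [d]. *)
have lt1 := swept_arc nd dT.
have nod' : nonroot_dart root (opp G d') by rewrite nonrootN.
have := swept_arc nod' (T_color (nonroot_org nod')).
rewrite k tgt_opp add2_sub1 -[org (opp G d')]/(tgt d') -vw' swept_add2_lt // => lt2.
have : (j - 1 == i) || (j - 1 == i + 2%:R).
  by rewrite -odd_eqP odd_sub1; move: par; case: (odd i); case: (odd j).
move: btw; case/orP=> /andP[b1 b2] /orP[]/eqP ji; move: lt1 lt2; rewrite ji.
- by rewrite ltnNge => _; rewrite ltnNge b2.
- by rewrite swept_add2_lt // ltnNge (leq_trans b1 b2).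
- by rewrite ltnNge (leq_trans b1 b2).
- by move=> _; rewrite swept_add2_lt // ltnNge b1.
Qed.

Lemma swept_turn_cw d m : turn d -> (0 < m < #|face d|)%N ->
    turn (iter m (fnext G) d) ->
  swept (color d) (tgt (iter m (fnext G) d)) = (swept (color d) (tgt d)).+1.
Proof.
move=> td mN tm; have [_ _ turnF _] := root_face_count.
have /nonroot_tgt vr : nonroot_dart root d by case/andP: td.
have [fS /left_region eqR] := left_of_turn_cw td mN tm (left_of_region _ vr).
by rewrite !sweptE eqR card_setI1 // turnF.
Qed.

Lemma swept_turn_ccw d m i : turn d -> (0 < m < #|face d|)%N ->
    turn (iter m (fnext G) d) -> i = color d + 1 ->
  swept i (org (iter m (fnext G) d)) = (swept i (org d)).+1.
Proof.
move=> td mN tm ci; have [_ _ turnF _] := root_face_count.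
have /nonroot_org vr : nonroot_dart root d by case/andP: td.
have [fS /left_region eqR] := left_of_turn_ccw td mN tm ci (left_of_region _ vr).
by rewrite !sweptE eqR card_setI1 // turnF.
Qed.

Lemma swept_first i : swept i (tgt (e (i + 1))) = 0%N.
Proof.
rewrite sweptE (left_region (left_of_first i)).
apply/eqP; rewrite cards_eq0; apply/eqP/setP => f; rewrite in_setI in_set2 in_set0.
apply/negP=> /andP[fF /orP[]/eqP fE]; move: fF; rewrite fE;
  by apply/negP/face_e_root.
Qed.

Lemma swept_end i : swept i (tgt (e (i + 3%:R))) = #|nonroot_faces root|.
Proof. by rewrite sweptE (swept_last (left_of_region i (tgt_e _))). Qed.

(** * Face colors and sums over darts *)

Section BlackFaces.
Variable black : {set dart G} -> bool.
Hypotheses (black_coloring : face_coloring black) (black_root : black (face (e 1))).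

Lemma black_color d : org d != root -> black (face d) = ~~ odd (color d).
Proof.
(* Darts leaving the root have no color of their own, so the parity is read on the reverse dart.
   This [pi] flips under [opp] and is constant along contours, as [black] is. *)
pose pi d := if org d == root then odd (color (opp G d)) else ~~ odd (color d).
suff H z : black (face z) == pi z.
  by move=> dr; rewrite (eqP (H d)) /pi (negPf dr).
apply: (dart_ind (P := fun z => black (face z) == pi z) (d0 := e 1)) z.
- move=> z /eqP bz; rewrite black_coloring bz /pi oppK -/(tgt z).
  case: (eqVneq (org z) root) => oz; case: (eqVneq (tgt z) root) => tz;
    rewrite ?oz ?tz ?negbK //.
    by move: (loopless z); rewrite -/(tgt z) oz tz eqxx.
  by rewrite eq_sym -eqbF_neg; have := color_odd (d := z);
    rewrite /nonroot_dart oz tz => /(_ isT); case: (odd _); case: (odd _).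
- move=> z /eqP bz; rewrite face_fnext bz /pi org_fnext.
  case: (eqVneq (tgt z) root) => [tz|tz].
    have [l ->] := rootarcP tz; rewrite fnext_opp_e !color_opp_e -/(tgt (e l)).
    by rewrite (negPf (tgt_e l)) odd_add1.
  rewrite color_fnext // odd_sub1 negbK; case: (eqVneq (org z) root) => oz //.
  by have := color_odd (d := z); rewrite /nonroot_dart oz tz => /(_ isT);
    case: (odd _); case: (odd _).
by rewrite black_root /pi org_e eqxx color_opp_e.
Qed.

End BlackFaces.

(** The two turns of a face have colors differing by 2, so both colors of the given parity occur and
    the first special edge can be chosen by its color. *)
Lemma nonroot_face_turn f c : f \in nonroot_faces root ->
  (forall d, d \in f -> odd (color d) = odd c) ->
  exists d, [/\ d \in f, turn d & color d = c].
Proof.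
move=> fF oddf; have [d df td] := face_turn fF.
have := oddf d df => /esym/eqP; rewrite odd_eqP => /orP[]/eqP cd.
  by exists d; split.
have [m [mN tk c1 _]] := turn_seq td; exists (iter m (fnext G) d); split.
- have ff : f \in faces G by move: fF; rewrite inE => /andP[].
  by move: df; rewrite !mem_faces // iter_face.
- by rewrite tk ?inE ?eqxx ?orbT //; case/andP: mN.
by rewrite c1 ?leqnn ?andbT; [rewrite cd add2_add2 | case/andP: mN].
Qed.

Lemma dart_cases d :
  nonroot_dart root d \/ exists i, d = e i \/ d = opp G (e i).
Proof.
case nd: (nonroot_dart root d); [by left | right].
have : d \in ~: [set d | nonroot_dart root d] by rewrite !inE nd.
rewrite nonroot_darts_compl in_setU => /orP[]/imsetP[i _ ->]; exists i; by [left|right].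
Qed.

Lemma sum_darts (F : dart G -> nat) : (\sum_d F d =
  \sum_(d | nonroot_dart root d) F d + \sum_i (F (e i) + F (opp G (e i))))%N.
Proof.
rewrite (bigID (nonroot_dart root)) /=; congr addn; rewrite big_split /=.
have oi : injective (fun i => opp G (e i)) by move=> i j /perm_inj/e_inj.
transitivity (\sum_(d in [set e i | i : 'Z_4] :|: [set opp G (e i) | i : 'Z_4]) F d)%N.
  by apply: eq_bigl => d; rewrite -nonroot_darts_compl !inE.
rewrite (eq_bigl [predU [set e i | i : 'Z_4] & [set opp G (e i) | i : 'Z_4]]); last first.
  by move=> d; rewrite in_setU.
rewrite bigU ?big_imset //=.
- by move=> i j _ _ /oi.
- by move=> i j _ _ /e_inj.
apply/pred0P=> d /=; apply/negP=> /andP[/imsetP[i _ ->]].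
case/imsetP=> j _ eqd; have := tgt_e j; by rewrite /tgt -eqd org_e eqxx.
Qed.

Lemma arc_order d : nonroot_dart root d ->
  match nat_of_ord (color d) with
  | 1%N => (swept 0%R (tgt d) < swept 0%R (org d))%N
  | 2%N => (swept 1%R (tgt d) < swept 1%R (org d))%N
  | 3%N => (swept 0%R (org d) < swept 0%R (tgt d))%N
  | _ => (swept 1%R (org d) < swept 1%R (tgt d))%N
  end.
Proof.
move=> nd; have ord := swept_arc nd (T_color (nonroot_org nd)); move: ord.
have vr := nonroot_org nd; have wr := nonroot_tgt nd.
have e3 : 0 - 1 = 1 + 2%:R :> 'Z_4 by apply/eqP.
have e2 : 3%:R - 1 = 0 + 2%:R :> 'Z_4 by apply/eqP.
have e1 : 2%:R - 1 = 1 :> 'Z_4 by apply/eqP.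
case: (Z4P (color d)) => -> /=.
- by rewrite e3 swept_add2_lt.
- by rewrite subrr.
- by rewrite e1.
- by rewrite e2 swept_add2_lt.
Qed.

(** * The drawing *)

Section Drawing.
Variable R : realFieldType.
Implicit Types (q : point R).

Let x := swept 1.
Let y := swept 0.
Let N := #|nonroot_faces root|.

Definition place v : point R := ((x v)%:R, (y v)%:R).

Definition bend d : point R :=
  if odd (color d) then ((x (org d))%:R, (y (tgt d))%:R)
  else ((x (tgt d))%:R, (y (org d))%:R).

Lemma bend_opp d : nonroot_dart root d -> bend (opp G d) = bend d.
Proof.
move=> nd; have := color_odd nd; rewrite /bend tgt_opp -/(tgt d).
by case: (odd (color d)); case: (odd (color _)).
Qed.

Lemma points_bend d : nonroot_dart root d -> points (color d) (place (org d)) (bend d).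
Proof.
move=> nd; apply/pointsE; have := arc_order nd; rewrite /bend.
by case: (Z4P (color d)) => -> /= lt; rewrite ltr_nat.
Qed.

Lemma points_bend_opp d : nonroot_dart root d ->
  points (color (opp G d)) (place (tgt d)) (bend d).
Proof.
move=> nd; rewrite -bend_opp // -/(tgt (opp G d)); apply: points_bend.
by rewrite nonrootN.
Qed.

Lemma place_inj v w : v != root -> w != root -> place v = place w -> v = w.
Proof. by move=> vr wr [/eqP]; rewrite eqr_nat => /eqP/(swept_inj vr wr). Qed.

Lemma x_inj v w : v != root -> w != root -> (x v)%:R = (x w)%:R :> R -> v = w.
Proof. by move=> vr wr /eqP; rewrite eqr_nat => /eqP/(swept_inj vr wr). Qed.

Lemma y_inj v w : v != root -> w != root -> (y v)%:R = (y w)%:R :> R -> v = w.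
Proof. by move=> vr wr /eqP; rewrite eqr_nat => /eqP/(swept_inj vr wr). Qed.

Lemma between_nat (a b c : nat) : between (a%:R : R) b%:R c%:R ->
  (b <= c <= a)%N || (a <= c <= b)%N.
Proof. by rewrite /between !ler_nat => -[] [-> ->]; rewrite ?orbT. Qed.

Definition arm d q := on_segment (place (org d), bend d) q.

Lemma armE d q : arm d q ->
  if odd (color d) then q.1 = (x (org d))%:R /\ between (y (org d))%:R (y (tgt d))%:R q.2
  else q.2 = (y (org d))%:R /\ between (x (org d))%:R (x (tgt d))%:R q.1.
Proof.
move/on_segment_box; rewrite /bend /=; case: (odd _) => /= -[b1 b2]; split=> //;
  exact: between_eq.
Qed.

Lemma arms_cross d d' : nonroot_dart root d -> nonroot_dart root d' ->
  org d != org d' -> ~~ odd (color d) -> odd (color d') ->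
  between (x (org d))%:R (x (tgt d))%:R ((x (org d'))%:R : R) ->
  between (y (org d'))%:R (y (tgt d'))%:R ((y (org d))%:R : R) -> d = opp G d'.
Proof.
move=> nd nd' ne ev od /between_nat bx /between_nat by_.
have vr := nonroot_org nd; have wr := nonroot_org nd'.
have v'r := nonroot_tgt nd; have w'r := nonroot_tgt nd'.
have par : odd (color d') != odd (color d) by rewrite (negPf ev) od.
apply: (perpendicular_arcs nd nd' ne (T_color vr) (T_color wr) par).
  have : (color d' == 1) || (color d' == 1 + 2%:R) by rewrite -odd_eqP od.
  case/orP=> /eqP->; first exact: bx.
  rewrite (swept_add2_le 1 v'r wr) (swept_add2_le 1 wr vr).
  rewrite (swept_add2_le 1 vr wr) (swept_add2_le 1 wr v'r).
  by rewrite orbC andbC [X in _ || X]andbC.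
move: by_; have := arc_order nd'; move: od.
have e2 : 3%:R - 1 = 0 + 2%:R :> 'Z_4 by apply/eqP.
case: (Z4P (color d')) => -> //= _ lt.
  rewrite subrr; case/orP=> [//|/andP[b1 b2]].
  by have := leq_trans b1 b2; rewrite leqNgt lt.
rewrite e2 (swept_add2_le 0 w'r vr) (swept_add2_le 0 vr wr).
case/orP=> [/andP[b1 b2]|]; last by rewrite andbC.
by have := leq_trans b1 b2; rewrite leqNgt lt.
Qed.

(** Parallel arms on one line have the same origin, because coordinates are injective, and then
    point in opposite directions. Perpendicular arms with different origins could only belong to the
    same edge. *)
Lemma arms_meet d d' q : nonroot_dart root d -> nonroot_dart root d' ->
  edge d != edge d' -> arm d q -> arm d' q -> org d = org d' /\ q = place (org d).
Proof.
move=> nd nd' ne a1 a2; move: (armE a1) (armE a2) => {a1 a2}.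
rewrite edge_eq negb_or in ne; have /andP[n1 n2] := ne.
have vr := nonroot_org nd; have wr := nonroot_org nd'.
have := arc_order nd; have := arc_order nd'; rewrite -/x -/y => lt2 lt1.
rewrite (surjective_pairing q); move: q.1 q.2 => q1 q2 /=.
have same : org d = org d' -> color d != color d'.
  by move=> oo; apply: contraNneq n1 => cc; apply/eqP/arc_uniq.
case o1 : (odd (color d)); case o2 : (odd (color d')) => -[e1 b1] [e2 b2].
- have oo : org d = org d' by apply: (x_inj vr wr); rewrite -e1.
  split=> //; rewrite /place; congr pair => //; move: (same oo) o1 o2 lt1 lt2 b1 b2.
  rewrite -{}oo; move: (y (org d)) (y (tgt d)) (y (tgt d')) => k1 k2 k3.
  by case: (Z4P (color d)) => ->; case: (Z4P (color d')) => -> // _ _ _ /=;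
    rewrite -!(ltr_nat R) /between; lra.
- case: (eqVneq (org d) (org d')) => [oo|oo].
    by split=> //; rewrite /place; congr pair => //; rewrite oo.
  rewrite eq_sym in oo; rewrite e1 in b2; rewrite e2 in b1.
  have eqd := arms_cross nd' nd oo (negbT o2) o1 b2 b1.
  by case/eqP: n2; rewrite eqd oppK.
- case: (eqVneq (org d) (org d')) => [oo|oo].
    by split=> //; rewrite /place; congr pair => //; rewrite oo.
  rewrite e1 in b2; rewrite e2 in b1.
  have eqd := arms_cross nd nd' oo (negbT o1) o2 b1 b2.
  by case/eqP: n2.
- have oo : org d = org d' by apply: (y_inj vr wr); rewrite -e1.
  split=> //; rewrite /place; congr pair => //; move: (same oo) o1 o2 lt1 lt2 b1 b2.
  rewrite -{}oo; move: (x (org d)) (x (tgt d)) (x (tgt d')) => k1 k2 k3.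
  by case: (Z4P (color d)) => ->; case: (Z4P (color d')) => -> // _ _ _ /=;
    rewrite -!(ltr_nat R) /between; lra.
Qed.

Definition M : R := N%:R.

Lemma place_box v : in_box M (place v).
Proof. by rewrite /in_box /place /M /= !ler0n !ler_nat !swept_le. Qed.

Lemma bend_box d : in_box M (bend d).
Proof.
by rewrite /bend; case: ifP => _; rewrite /in_box /M /= !ler0n !ler_nat !swept_le.
Qed.

(** The sweep for y goes from the neighbor along root-edge 1 to that along 3, the sweep for x from
    the neighbor along 2 to that along 4. *)
Lemma place_side i : on_side M i (place (tgt (e i))).
Proof.
have f0 := swept_first 0; have f1 := swept_first 1.
have l0 := swept_end 0; have l1 := swept_end 1.
have e1 : 0 + 1 = 1 :> 'Z_4 by apply/eqP.
have e2 : 1 + 1 = 2%:R :> 'Z_4 by apply/eqP.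
have e3 : 0 + 3%:R = 3%:R :> 'Z_4 by apply/eqP.
have e4 : 1 + 3%:R = 0 :> 'Z_4 by apply/eqP.
rewrite e1 in f0; rewrite e2 in f1; rewrite e3 in l0; rewrite e4 in l1.
by case: (Z4P i) => ->; rewrite /on_side /= /x /y ?f0 ?f1 ?l0 ?l1.
Qed.

Lemma arm_box d q : arm d q -> in_box M q.
Proof.
move/on_segment_box => -[].
have [/= p1 p2 p3 p4] := place_box (org d); have [b1 b2 b3 b4] := bend_box d.
by rewrite /between /in_box => -[] [? ?] [] [? ?]; split; lra.
Qed.

(** * The drawing with the root and its edges *)

Definition pos v : point R := if v == root then root_point R else place v.

Definition bends d : seq (point R) :=
  if org d == root then rev (root_bends M (color (opp G d)) (place (tgt d)))
  else if tgt d == root then root_bends M (color d) (place (org d))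
  else [:: bend d].

Lemma pos_nonroot v : v != root -> pos v = place v.
Proof. by rewrite /pos => /negPf->. Qed.

Lemma pos_root : pos root = root_point R. Proof. by rewrite /pos eqxx. Qed.

Lemma bends_nonroot d : nonroot_dart root d -> bends d = [:: bend d].
Proof. by rewrite /bends => /andP[/negPf-> /negPf->]. Qed.

Lemma bends_e i : bends (e i) = rev (root_bends M i (place (tgt (e i)))).
Proof. by rewrite /bends org_e eqxx color_opp_e. Qed.

Lemma bends_opp_e i : bends (opp G (e i)) = root_bends M i (place (tgt (e i))).
Proof.
by rewrite /bends -/(tgt (e i)) (negPf (tgt_e i)) tgt_opp org_e eqxx color_opp_e.
Qed.

Lemma polyline_nonroot d : nonroot_dart root d ->
  polyline pos bends d = [:: place (org d); bend d; place (tgt d)].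
Proof.
by move=> nd; rewrite /polyline bends_nonroot // !pos_nonroot //;
  case/andP: nd.
Qed.

Lemma polyline_e i : polyline pos bends (e i) =
  root_point R :: rcons (rev (root_bends M i (place (tgt (e i))))) (place (tgt (e i))).
Proof. by rewrite /polyline bends_e org_e pos_root pos_nonroot // tgt_e. Qed.

Lemma polyline_opp_e i : polyline pos bends (opp G (e i)) =
  place (tgt (e i)) :: rcons (root_bends M i (place (tgt (e i)))) (root_point R).
Proof.
by rewrite /polyline bends_opp_e tgt_opp org_e pos_root -/(tgt (e i)) pos_nonroot ?tgt_e.
Qed.

Lemma on_polyline_nonroot d q : nonroot_dart root d ->
  on_polyline (polyline pos bends d) q -> arm d q \/ arm (opp G d) q.
Proof.
move=> nd; rewrite polyline_nonroot // => /on_polyline3[]; first by left.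
by move/on_segment_sym; right; rewrite /arm bend_opp.
Qed.

Lemma on_polyline_root i d q : d \in edge (e i) ->
  on_polyline (polyline pos bends d) q ->
  root_line M i (place (tgt (e i))) q.
Proof.
rewrite edgeE !inE => /orP[]/eqP->; rewrite ?polyline_e ?polyline_opp_e => qp;
  apply: on_root_line; [exact: place_box | by right | exact: place_box | by left].
Qed.

Lemma polyline_shape d : orthogonal_polyline (polyline pos bends d) /\
  simple_polyline (polyline pos bends d).
Proof.
case: (dart_cases d) => [nd|[i [->|->]]]; last 2 first.
- rewrite polyline_e.
  by have [_] := root_bends_polyline (place_box (tgt (e i))) (place_side i).
- rewrite polyline_opp_e.
  by have [] := root_bends_polyline (place_box (tgt (e i))) (place_side i).
rewrite polyline_nonroot //.
apply: (@elbow_polyline _ (color d) (color (opp G d))); last exact: color_odd.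
  by left; apply: points_bend.
by right; apply: points_bend_opp.
Qed.

Lemma pos_inj : injective pos.
Proof.
have ne v : root_point R <> place v.
  by case=> eq1 _; have := ler0n R (x v); rewrite -eq1; lra.
move=> v w; rewrite /pos; case: (eqVneq v root) => [->|vr].
  by case: (eqVneq w root) => [->//|_] /ne.
by case: (eqVneq w root) => [_ /esym/ne//|wr]; apply: place_inj.
Qed.

Lemma root_not_in_box : ~ in_box M (root_point R).
Proof. by case=> /=; lra. Qed.

Lemma arm_place d v : nonroot_dart root d -> v != root -> arm d (place v) ->
  v = org d.
Proof.
by move=> nd vr /armE; have wr := nonroot_org nd;
  case: ifP => _ -[/= eqv _]; [apply: x_inj | apply: y_inj].
Qed.

Lemma vertex_on_polyline v d : on_polyline (polyline pos bends d) (pos v) ->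
  v = org d \/ v = tgt d.
Proof.
case: (dart_cases d) => [nd|[i di]].
  have nd' : nonroot_dart root (opp G d) by rewrite nonrootN.
  move/(on_polyline_nonroot nd); case: (eqVneq v root) => [->|vr].
    by rewrite pos_root => -[] /arm_box/root_not_in_box.
  by rewrite pos_nonroot // => -[] /arm_place ->; by [left | right | ].
have de : d \in edge (e i).
  by rewrite edgeE !inE; case: di => ->; rewrite eqxx ?orbT.
move/(on_polyline_root de); case: (eqVneq v root) => [->|vr] qp.
  by case: di => ->; [left; rewrite org_e | right; rewrite tgt_opp org_e].
rewrite pos_nonroot // in qp.
have := root_line_box (place_box _) (place_side i) (place_box v) qp.
move/place_inj => -> //; last exact: tgt_e.
by case: di => ->; [right | left].
Qed.

Lemma polylines_meet d d' q : edge d != edge d' ->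
  on_polyline (polyline pos bends d) q -> on_polyline (polyline pos bends d') q ->
  exists v, [/\ q = pos v, v \in [set org d; tgt d] & v \in [set org d'; tgt d']].
Proof.
have end_in v z : v = org z \/ v = tgt z -> v \in [set org z; tgt z].
  by rewrite !inE => -[]->; rewrite eqxx ?orbT.
have mem_edge z i : z = e i \/ z = opp G (e i) -> z \in edge (e i).
  by rewrite edgeE !inE => -[]->; rewrite eqxx ?orbT.
have edge_mem z i : z \in edge (e i) -> edge z = edge (e i) by exact: porbit_eq.
have box i z : z \in edge (e i) -> on_polyline (polyline pos bends z) q ->
    in_box M q -> q = pos (tgt (e i)).
  move=> ze /(on_polyline_root ze) qp qb; rewrite pos_nonroot ?tgt_e //.
  exact: root_line_box (place_box _) (place_side i) qb qp.
(* A root-edge touches the box only at its nonroot end, so a meeting point inside the box is a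
   vertex, and it suffices to know which polylines contain it. *)
have finish z z' i : z \in edge (e i) -> on_polyline (polyline pos bends z) q ->
    on_polyline (polyline pos bends z') q -> in_box M q ->
    exists v, [/\ q = pos v, v \in [set org z; tgt z] & v \in [set org z'; tgt z']].
  move=> ze qz qz' qb; have qe := box _ _ ze qz qb; exists (tgt (e i)).
  by split=> //; apply/end_in/vertex_on_polyline; rewrite -qe.
case: (dart_cases d) => [nd|[i /mem_edge di]];
  case: (dart_cases d') => [nd'|[j /mem_edge dj]] ne qd qd'.
- have no : nonroot_dart root (opp G d) by rewrite nonrootN.
  have no' : nonroot_dart root (opp G d') by rewrite nonrootN.
  have eo z : edge (opp G z) = edge z.
    by apply/eqP; rewrite edge_eq eqxx orbT.
  have meet z z' : nonroot_dart root z -> nonroot_dart root z' ->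
      edge z = edge d -> edge z' = edge d' -> arm z q -> arm z' q ->
      org z = org z' /\ q = pos (org z).
    move=> nz nz' ez ez' az az'; rewrite pos_nonroot ?nonroot_org //.
    by apply: arms_meet az az'; rewrite ?ez ?ez'.
  case: (on_polyline_nonroot nd qd) => a1; case: (on_polyline_nonroot nd' qd') => a2.
  + have [eqo ->] := meet _ _ nd nd' erefl erefl a1 a2; exists (org d); split=> //;
      apply: end_in; by left.
  + have [eqo ->] := meet _ _ nd no' erefl (eo d') a1 a2; exists (org d); split=> //;
      apply: end_in; [by left | by right].
  + have [eqo ->] := meet _ _ no nd' (eo d) erefl a1 a2; exists (tgt d); split=> //;
      apply: end_in; [by right | by left].
  + have [eqo ->] := meet _ _ no no' (eo d) (eo d') a1 a2; exists (tgt d); split=> //;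
      apply: end_in; by right.
- have qb : in_box M q by case: (on_polyline_nonroot nd qd) => /arm_box.
  by have [v [qv v1 v2]] := finish _ _ _ dj qd' qd qb; exists v.
- have qb : in_box M q by case: (on_polyline_nonroot nd' qd') => /arm_box.
  exact: finish di qd qd' qb.
have ij : i != j.
  by apply: contraNneq ne => ij; rewrite (edge_mem _ _ di) (edge_mem _ _ dj) ij.
case: (root_line_meet (place_box _) (place_side i) (place_box _) (place_side j) ij
  (on_polyline_root di qd) (on_polyline_root dj qd')) => [qr|];
  last exact: finish di qd qd'.
have re z k : z \in edge (e k) -> root \in [set org z; tgt z].
  move=> zk; apply: end_in; move: zk; rewrite edgeE !inE => /orP[]/eqP->.
    by left; rewrite org_e.
  by right; rewrite tgt_opp org_e.
by exists root; rewrite qr pos_root; split=> //; [apply: re di | apply: re dj].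
Qed.

Definition leaving d : 'Z_4 := if org d == root then 1 - color (opp G d) else color d.

Lemma leaves_leaving d : leaves pos bends d (leaving d).
Proof.
rewrite /leaves /leaving; case: (dart_cases d) => [nd|[i [->|->]]].
- rewrite bends_nonroot //= (negPf (nonroot_org nd)) pos_nonroot ?nonroot_org //.
  exact: points_bend.
- rewrite bends_e org_e eqxx color_opp_e pos_root pos_nonroot ?tgt_e //.
  exact: root_bends_arrive (place_box _).
rewrite bends_opp_e -/(tgt (e i)) (negPf (tgt_e i)) color_opp_e tgt_opp org_e pos_root.
by rewrite pos_nonroot ?tgt_e //; apply: root_bends_leave (place_box _) (place_side i).
Qed.

Lemma leavesE d i : leaves pos bends d i -> i = leaving d.
Proof. by move/points_uniq; apply; apply: leaves_leaving. Qed.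

Lemma leaving_iter d a : leaving (iter a (ccw G) d) = leaving d - a%:R.
Proof.
elim: a => [|a IH]; first by rewrite subr0.
rewrite iterS -natr1 opprD addrA -IH; move: (iter _ _ _) => {IH} z.
rewrite /leaving org_ccwE; case: (eqVneq (org z) root) => [|oz].
  case/root_dartP=> i ->; rewrite ccw_e !color_opp_e opprD addrA //.
by rewrite color_ccw.
Qed.

Lemma card_porbit_ccw d : #|porbit (ccw G) d| = 4%N.
Proof.
transitivity (degree (org d)); last exact: regular4.
by apply: eq_card => z; rewrite inE eq_sym org_ccw.
Qed.

Lemma bends_opp d : bends (opp G d) = rev (bends d).
Proof.
case: (dart_cases d) => [nd|[i [->|->]]].
- by rewrite !bends_nonroot ?nonrootN // bend_opp.
- by rewrite bends_opp_e bends_e revK.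
by rewrite oppK bends_opp_e bends_e.
Qed.

Lemma full_drawing : orthogonal_drawing pos bends setT setT.
Proof.
split; first by move=> d _; apply: bends_opp.
split; first by move=> v w _ _; apply: pos_inj.
split; first by move=> d _; apply: polyline_shape.
split; first by move=> v d _ _; apply: vertex_on_polyline.
split; first by move=> d d' q _ _; apply: polylines_meet.
move=> d a b i j k ab; rewrite card_porbit_ccw => b4 _ _ _.
move=> /leavesE-> /leavesE-> /leavesE->.
by exists a, b; rewrite !leaving_iter.
Qed.

Lemma nonroot_card : N = (#|vertex G| - 2)%N.
Proof. by have [<- _ _ _] := root_face_count; rewrite addnK. Qed.

Lemma two_vertices : (2 <= #|vertex G|)%N.
Proof. by have [<- _ _ _] := root_face_count; rewrite leq_addl. Qed.

Lemma polyline_place d : nonroot_dart root d ->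
  polyline place (fun d => [:: bend d]) d = polyline pos bends d.
Proof. by move=> nd; rewrite polyline_nonroot. Qed.

Lemma leaves_place d i : nonroot_dart root d ->
  leaves place (fun d => [:: bend d]) d i -> leaves pos bends d i.
Proof.
by move=> nd; rewrite /leaves bends_nonroot // pos_nonroot ?nonroot_org.
Qed.

Lemma partial_drawing : orthogonal_drawing place (fun d => [:: bend d])
  [set v | v != root] [set d | nonroot_dart root d].
Proof.
have [_ [_ [shape [on_pl [meet turn_order]]]]] := full_drawing.
split; first by move=> d; rewrite inE => nd; rewrite bend_opp.
split; first by move=> v w; rewrite !inE; apply: place_inj.
split; first by move=> d; rewrite inE => nd; rewrite polyline_place //; apply: shape.
split.
  move=> v d; rewrite !inE => vr nd; rewrite polyline_place // -pos_nonroot //.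
  exact: on_pl.
split.
  move=> d d' q; rewrite !inE => nd nd' ne; rewrite !polyline_place // => qd qd'.
  have [v [qv v1 v2]] := meet _ _ _ (in_setT _) (in_setT _) ne qd qd'.
  exists v; split=> //; rewrite qv pos_nonroot //.
  by move: v1; rewrite !inE => /orP[]/eqP->; case/andP: nd.
move=> d a b i j k ab bN; rewrite !inE => n1 n2 n3 /(leaves_place n1) l1.
move=> /(leaves_place n2) l2 /(leaves_place n3) l3.
exact: turn_order ab bN _ _ _ l1 l2 l3.
Qed.

Lemma rays_bend d i j q : nonroot_dart root d -> d \in T i -> opp G d \in T j ->
  (ray i (place (org d)) q /\ ray j (place (tgt d)) q) <-> q = bend d.
Proof.
move=> nd /color_T <- /color_T <-; split=> [|->]; last first.
  by split; apply: points_ray; [apply: points_bend | apply: points_bend_opp].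
case=> /ray_axis r1 /ray_axis r2; rewrite (surjective_pairing q) /bend.
have := color_odd nd; case: (odd (color d)) r1 => /= r1;
  by case: (odd _) r2 => /= r2 // _; rewrite r1 r2.
Qed.

Lemma T_points i d : nonroot_dart root d ->
  d \in T i <-> points i (place (org d)) (bend d).
Proof.
move=> nd; have pd := points_bend nd; split=> [/color_T <-//|pi].
by rewrite (points_uniq pi pd) T_color // nonroot_org.
Qed.

Lemma swept_onto i k : (k <= N)%N ->
  exists! v, v \in [set v | v != root] /\ swept i v = k.
Proof.
move=> /(sweep_exists i)[v [vr _ vk]]; exists v; split; first by rewrite inE.
by move=> w; rewrite inE => -[wr wk]; apply: (swept_inj (i := i) vr wr); rewrite vk wk.
Qed.

Lemma place_grid v : in_grid 0 0 N (place v).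
Proof.
exists (x v)%:Z, (y v)%:Z; rewrite !add0r !lez_nat !swept_le; split=> //.
Qed.

Lemma bend_grid d : in_grid 0 0 N (bend d).
Proof.
rewrite /bend; case: ifP => _.
  exists (x (org d))%:Z, (y (tgt d))%:Z; rewrite !add0r !lez_nat !swept_le; split=> //.
exists (x (tgt d))%:Z, (y (org d))%:Z; rewrite !add0r !lez_nat !swept_le; split=> //.
Qed.

(** The color of the reverse dart is the direction from the head to the bend; the second segment is
    traversed the other way, whence the shift by 2. *)
Lemma bent_colors d c c' : nonroot_dart root d -> color d = c ->
  color (opp G d) = c' + 2%:R -> bent place bend c c' d.
Proof.
move=> nd <- co; split; first exact: points_bend.
have := points_bend_opp nd; rewrite co => /pointsE H; apply/pointsE; move: H.
by case: (Z4P c') => -> /= [? ?]; split.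
Qed.

(* Reading the contour clockwise from a turn [d] of color [c]: up to the other
   turn the darts have color [c + 2], and then color [c] again.  The reverse of
   a dart has the color of the next dart plus one. *)
Lemma special_turn d c m : turn d -> color d = c ->
  [/\ (0 < m < #|face d|)%N, turn (iter m (fnext G) d),
     forall k, (0 < k <= m)%N -> color (iter k (fnext G) d) = color d + 2%:R
   & forall k, (m < k <= #|face d|)%N -> color (iter k (fnext G) d) = color d] ->
  special_contour place bend c (c + 1) (c + 2%:R) (c - 1) d m.
Proof.
move=> td cd [mN tm c1 c2]; have [_ _ turnF _] := root_face_count.
have nd k : nonroot_dart root (iter k (fnext G) d) by apply/face_nonroot_dart/turnF.
have next k : color (opp G (iter k (fnext G) d)) = color (iter k.+1 (fnext G) d) + 1.
  by rewrite iterS color_fnext ?subrK // nonroot_tgt.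
rewrite -{}cd in c1 c2 *.
split.
- split=> //; rewrite edge_eq; apply/norP; split; apply/eqP=> eqd.
    have := c1 m; rewrite eqd => H; have := add2_neq (color d).
    by rewrite -H ?eqxx //; lia.
  have := color_odd (nd 0%N); rewrite /= -eqd c1; last by lia.
  by rewrite odd_add2 eqxx.
- apply: bent_colors (nd 0%N) _ _ => //; rewrite (next 0%N) c1; last by lia.
  by rewrite addrAC.
- move=> k km; apply: bent_colors (nd k) _ _; first by rewrite c1 //; lia.
  rewrite next c1; [exact: addrAC | lia].
- apply: bent_colors (nd m) _ _; first by rewrite c1 //; lia.
  rewrite next c2; [by rewrite sub1_add2 | lia].
- move=> k km; apply: bent_colors (nd k) _ _; first by rewrite c2 //; lia.
  rewrite next c2; [by rewrite sub1_add2 | lia].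
Qed.

Lemma special_edges (black : {set dart G} -> bool) :
  face_coloring black -> black (face (e 1)) ->
  forall f, f \in nonroot_faces root -> exists (d : dart G) (m : nat), d \in f /\
    let a := org d in let a' := tgt d in
    let b := org (iter m (fnext G) d) in let b' := tgt (iter m (fnext G) d) in
    if black f then
      [/\ special_contour place bend right_ down_ left_ up_ d m,
          (x a + 1 = x b)%N & (y a' + 1 = y b')%N]
    else
      [/\ special_contour place bend up_ right_ down_ left_ d m,
          (x a')%:Z - 1 = (x b')%:Z & (y a + 1 = y b)%N].
Proof.
(* The bent-edge from a to a' starts to the right (color 0) in a black face and upwards (color 3) in
   a white one. Tails and heads of the two turns are consecutive in a sweep, which gives the unit
   steps. *)
move=> bc br f fF; pose c : 'Z_4 := if black f then 0 else 3%:R.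
have ff : f \in faces G by move: fF; rewrite inE => /andP[].
have [d df|d [df td cd]] := nonroot_face_turn (c := c) fF.
  have := black_color bc br (nonroot_org (nonroot_face_dart fF df)).
  move: (df); rewrite mem_faces // => /eqP->.
  by rewrite /c; case: (black f) => /esym; case: (odd _).
have [m [mN tk c1 c2]] := turn_seq td.
have tm : turn (iter m (fnext G) d).
  by rewrite tk ?inE ?eqxx ?orbT //; case/andP: mN.
exists d, m; split=> //=; have := special_turn td cd (And4 mN tm c1 c2).
have ccw_step := swept_turn_ccw td mN tm; have cw_step := swept_turn_cw td mN tm.
rewrite cd in ccw_step cw_step; rewrite {}/c in cd ccw_step cw_step *.
case: (black f) cd ccw_step cw_step => cd ccw_step cw_step sp.
  have e1 : 0 + 1 = 1 :> 'Z_4 by apply/eqP.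
  have e2 : 0 + 2%:R = 2%:R :> 'Z_4 by apply/eqP.
  have e3 : 0 - 1 = 3%:R :> 'Z_4 by apply/eqP.
  rewrite e1 e2 e3 in sp; split=> //; first by rewrite addn1 -(ccw_step 1).
  by rewrite addn1 /y cw_step.
have e1 : 3%:R + 1 = 0 :> 'Z_4 by apply/eqP.
have e2 : 3%:R + 2%:R = 1 :> 'Z_4 by apply/eqP.
have e3 : 3%:R - 1 = 2%:R :> 'Z_4 by apply/eqP.
have e4 : 3%:R = 1 + 2%:R :> 'Z_4 by apply/eqP.
rewrite e1 e2 e3 in sp; split=> //; last by rewrite addn1 -(ccw_step 0).
have vr := nonroot_tgt (nonroot_face_dart fF df).
have wr : tgt (iter m (fnext G) d) != root by case/andP: tm => /nonroot_tgt.
(* Color 3 counts the complement of x: one more face there is one less for x. *)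
have := swept_add2 1 vr; have := swept_add2 1 wr; move: cw_step; rewrite e4 => ->.
rewrite -/x; move: (swept _ _) (x _) (x _) => k1 k2 k3; rewrite -/N; lia.
Qed.

Lemma T_leaves i d : org d != root -> d \in T i <-> leaves pos bends d i.
Proof.
move=> dr; have := leaves_leaving d; rewrite /leaving (negPf dr) => ld.
split=> [/color_T <-//|/leavesE ->]; by rewrite /leaving (negPf dr) T_color.
Qed.

(** * Grid lines and number of bends *)

Lemma grid_node (a b : int) q : q = (a%:~R, b%:~R) ->
  - 2%:Z <= a <= N%:Z + 1 -> - 2%:Z <= b <= N%:Z + 1 ->
  in_grid (- 2%:Z) (- 2%:Z) (#|vertex G| + 1) q.
Proof.
move=> qE a_range b_range; exists a, b; have := two_vertices; have := nonroot_card.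
by move: #|vertex G| N a_range b_range => n' k *; split=> //; lia.
Qed.

Lemma root_bends_grid i v q : q \in root_bends M i (place v) ->
  in_grid (- 2%:Z) (- 2%:Z) (#|vertex G| + 1) q.
Proof.
have := swept_le 1 v; have := swept_le 0 v.
have toR (k : nat) : (k%:Z)%:~R = k%:R :> R by [].
have m1 : (-1)%:~R = -1 :> R by rewrite mulrN1z.
have m2 : (- 2%:Z)%:~R = - 2%:R :> R by rewrite rmorphN.
have mM : (N%:Z + 1)%:~R = M + 1 :> R by rewrite rmorphD.
rewrite -/N -/(x v) -/(y v); move=> ly lx.
case: (Z4P i) => ->; rewrite /root_bends /= !inE;
  [move=> /or3P[]/eqP-> | move/eqP=> -> | move/eqP=> -> | move=> /or3P[]/eqP->].
- apply: (@grid_node (N%:Z + 1) (y v)%:Z); rewrite ?mM ?toR //; lia.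
- apply: (@grid_node (N%:Z + 1) (- 2%:Z)); rewrite ?mM ?m2 //; lia.
- apply: (@grid_node (-1) (- 2%:Z)); rewrite ?m1 ?m2 //; lia.
- apply: (@grid_node (x v)%:Z (-1)); rewrite ?m1 ?toR //; lia.
- apply: (@grid_node (-1) (y v)%:Z); rewrite ?m1 ?toR //; lia.
- apply: (@grid_node (x v)%:Z (N%:Z + 1)); rewrite ?mM ?toR //; lia.
- apply: (@grid_node (- 2%:Z) (N%:Z + 1)); rewrite ?mM ?m2 //; lia.
- apply: (@grid_node (- 2%:Z) (-1)); rewrite ?m1 ?m2 //; lia.
Qed.

Lemma drawn_node_grid q : drawn_node pos bends q ->
  in_grid (- 2%:Z) (- 2%:Z) (#|vertex G| + 1) q.
Proof.
have inner (r : point R) : in_grid 0 0 N r ->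
    in_grid (- 2%:Z) (- 2%:Z) (#|vertex G| + 1) r.
  by case=> a [b [-> ra rb]]; apply: (@grid_node a b) => //; lia.
case=> [[v ->]|[d]].
  case: (eqVneq v root) => [->|vr]; last by rewrite pos_nonroot //; apply/inner/place_grid.
  by rewrite pos_root; apply: (@grid_node (-1) (-1)); rewrite ?mulrN1z //; lia.
case: (dart_cases d) => [nd|[i [->|->]]].
- by rewrite bends_nonroot // inE => /eqP->; apply/inner/bend_grid.
- by rewrite bends_e mem_rev; apply: root_bends_grid.
by rewrite bends_opp_e; apply: root_bends_grid.
Qed.

(** The three added lines in each direction are [-2] and [N + 1], which carry bends of root-edges 3
    and 4, and [-1], which carries the root; each other line carries a vertex. *)
Lemma grid_full (k : int) : - 2%:Z <= k <= - 2%:Z + (#|vertex G| + 1)%N%:Z ->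
  (exists2 q, drawn_node pos bends q & q.1 = k%:~R) /\
  (exists2 q, drawn_node pos bends q & q.2 = k%:~R).
Proof.
move=> kr; have m1 : (-1)%:~R = -1 :> R by rewrite mulrN1z.
have m2 : (- 2%:Z)%:~R = - 2%:R :> R by rewrite rmorphN.
have mM : (N%:Z + 1)%:~R = M + 1 :> R by rewrite rmorphD.
have node i q : q \in root_bends M i (place (tgt (e i))) -> drawn_node pos bends q.
  by right; exists (opp G (e i)); rewrite bends_opp_e.
have : [\/ k = - 2%:Z, k = -1, k = N%:Z + 1 | exists2 j : nat, (j <= N)%N & k = j%:Z].
  have := nonroot_card; have := two_vertices; move: kr.
  move: #|vertex G| N => n' N' kr' n2 eN.
  case: k kr' => k kr'; last by case: k kr' => [|[|k]] kr';
    [constructor 2 | constructor 1 | lia].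
  case: (leqP k N') => kN; first by constructor 4; exists k.
  by constructor 3; lia.
case=> [->|->|->|[j jN ->]].
- split; rewrite ?m2; [exists (- 2%:R, -1) | exists (M + 1, - 2%:R)] => //;
    [apply: (node 3%:R) | apply: (node 0)];
    by rewrite /root_bends /= !inE eqxx ?orbT.
- rewrite m1; split; exists (root_point R) => //; left; exists root; by rewrite pos_root.
- split; rewrite ?mM; [exists (M + 1, - 2%:R) | exists (- 2%:R, M + 1)] => //;
    [apply: (node 0) | apply: (node 3%:R)];
    by rewrite /root_bends /= !inE eqxx ?orbT.
have [v [vr _ vx]] := sweep_exists 1 jN; have [w [wr _ wy]] := sweep_exists 0 jN.
split; [exists (place v) | exists (place w)].
- by left; exists v; rewrite pos_nonroot.
- by rewrite /place /= /x vx.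
- by left; exists w; rewrite pos_nonroot.
by rewrite /place /= /y wy.
Qed.

Lemma size_root_bends i p : size (root_bends M i p) =
  if i \in [set 1; 2%:R : 'Z_4] then 1%N else 3%N.
Proof. by rewrite !inE; case: (Z4P i) => ->. Qed.

Lemma size_bends_e i :
  size (bends (e i)) = if i \in [set 1; 2%:R : 'Z_4] then 1%N else 3%N.
Proof. by rewrite bends_e size_rev size_root_bends. Qed.

Lemma sum_bends_e : (\sum_(i : 'Z_4) size (bends (e i)) = 8)%N.
Proof.
under eq_bigr do rewrite size_bends_e !inE.
by rewrite !big_ord_recl big_ord0.
Qed.

Lemma nb_bends_full : nb_bends bends = (2 * #|vertex G| + 4)%N.
Proof.
rewrite /nb_bends (sum_darts (fun d => size (bends d))).
under eq_bigr => d nd do rewrite bends_nonroot //=.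
under [X in (_ + X)%N]eq_bigr do rewrite bends_opp size_rev addnn.
have -> : (\sum_i (size (bends (e i))).*2 = 16)%N.
  by under eq_bigr do rewrite -muln2; rewrite -big_distrl /= sum_bends_e.
rewrite sum1_card (eq_card (B := [set d | nonroot_dart root d])); last first.
  by move=> d; rewrite !inE.
(* Counted over darts: 4n - 8 from the edges not at the root and 16 from the root-edges. *)
by rewrite -[RHS]doubleK; congr half; have := card_nonroot_darts; lia.
Qed.

End Drawing.
End Decomposition.

Transparent swept.

Theorem theorem6p4 (R : realFieldType) (G : planeMap) (root : vertex G)
  (e : 'Z_4 -> dart G) (T : 'Z_4 -> {set dart G})
  (black : {set dart G} -> bool)
  (regular4 : forall v : vertex G, degree v = 4%N)
  (mincut4 : has_mincut G 4)
  (root_e : root_edges root e)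
  (T_regular : regular_decomposition root e T)
  (T_even : even_decomposition root T)
  (black_coloring : face_coloring black)
  (* the face on the right of [e 1] lies between the root-edges 4 and 1 *)
  (black_root : black (face (e 1))) :
  let n := #|vertex G| in
  let x := xcoord root e T in
  let y := ycoord root e T in
  let p := fun v : vertex G => ((x v)%:R, (y v)%:R) : point R in
  let W := [set v : vertex G | v != root] in
  let A := [set d : dart G | nonroot_dart root d] in
  exists pe : dart G -> point R,
    (* (a) *)
    (forall (d : dart G) (i j : 'Z_4), d \in A -> d \in T i -> opp G d \in T j ->
       forall q : point R,
         (ray i (p (org d)) q /\ ray j (p (tgt d)) q) <-> q = pe d) /\
    (* (b) *)
    orthogonal_drawing p (fun d => [:: pe d]) W A /\
    (forall v, v \in W -> in_grid 0 0 (n - 2) (p v)) /\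
    (forall d, d \in A -> in_grid 0 0 (n - 2) (pe d)) /\
    (* (b1) *)
    (forall k : nat, (k <= n - 2)%N ->
       (exists! v, v \in W /\ x v = k) /\ (exists! v, v \in W /\ y v = k)) /\
    (* (b2) *)
    (forall (i : 'Z_4) (d : dart G), d \in A ->
       (d \in T i <-> points i (p (org d)) (pe d))) /\
    (* (b3) *)
    (forall f, f \in nonroot_faces root ->
       exists (d : dart G) (m : nat), d \in f /\
         let a := org d in let a' := tgt d in
         let b := org (iter m (fnext G) d) in
         let b' := tgt (iter m (fnext G) d) in
         if black f then
           [/\ special_contour p pe right_ down_ left_ up_ d m,
               (x a + 1 = x b)%N & (y a' + 1 = y b')%N]
         else
           [/\ special_contour p pe up_ right_ down_ left_ d m,
               (x a')%:Z - 1 = (x b')%:Z & (y a + 1 = y b)%N]) /\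
    (* (c) *)
    exists (pos : vertex G -> point R) (bends : dart G -> seq (point R)),
      (forall v, v \in W -> pos v = p v) /\
      (forall d, d \in A -> bends d = [:: pe d]) /\
      orthogonal_drawing pos bends setT setT /\
      (* the arcs of the trees that end at the root also satisfy (b2) *)
      (forall (i : 'Z_4) (d : dart G), org d != root ->
         (d \in T i <-> leaves pos bends d i)) /\
      (* the grid has 3 more rows and 3 more columns, all of them used *)
      (exists x0 y0 : int,
         [/\ - 3%:Z <= x0 <= 0 /\ - 3%:Z <= y0 <= 0,
             forall q, drawn_node pos bends q -> in_grid x0 y0 (n + 1) q,
             forall k : int, x0 <= k <= x0 + (n + 1)%:Z ->
               exists2 q, drawn_node pos bends q & q.1 = k%:~R
           & forall k : int, y0 <= k <= y0 + (n + 1)%:Z ->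
               exists2 q, drawn_node pos bends q & q.2 = k%:~R]) /\
      (exists2 I : {set 'Z_4}, #|I| = 2%N &
         forall i, size (bends (e i)) = if i \in I then 1%N else 3%N) /\
      (\sum_(i : 'Z_4) size (bends (e i)) = 8)%N /\
      nb_bends bends = (2 * n + 4)%N.
Proof.
move=> n x y p W A.
have nE : (n - 2)%N = #|nonroot_faces root|.
  by rewrite (nonroot_card regular4 root_e T_regular T_even).
(* [x] and [y] are convertible to [swept 1] and [swept 0], so the facts about [place] and [bend]
   apply as they stand. *)
exists (bend root e T R).
split.
  move=> d i j; rewrite inE => nd dT dT' q.
  exact: (rays_bend regular4 root_e T_regular T_even q nd dT dT').
split; first exact: (partial_drawing regular4 root_e T_regular T_even R).
split; first by move=> v _; rewrite nE; apply: place_grid.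
split; first by move=> d _; rewrite nE; apply: bend_grid.
split.
  move=> k; rewrite nE => kN.
  by split; apply: (swept_onto regular4 root_e T_regular T_even).
split.
  move=> i d; rewrite inE; exact: (T_points regular4 root_e T_regular T_even).
split.
  exact: (special_edges regular4 root_e T_regular T_even R black_coloring black_root).
exists (pos root e T R), (bends root e T R).
split; first by move=> v; rewrite inE; apply: pos_nonroot.
split; first by move=> d; rewrite inE; apply: bends_nonroot.
split; first exact: (full_drawing regular4 root_e T_regular T_even R).
split; first by move=> i d; apply: (T_leaves regular4 root_e T_regular T_even).
split.
  have range (k : int) : - 2%:Z <= k <= - 2%:Z + (n + 1)%N%:Z ->
    _ := grid_full regular4 root_e T_regular T_even R (k := k).
  exists (- 2%:Z), (- 2%:Z); split=> //.
  - exact: (drawn_node_grid regular4 root_e T_regular T_even).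
  - by move=> k /range[].
  - by move=> k /range[].
split.
  exists [set 1; 2%:R]; first by rewrite cards2.
  by move=> i; apply: size_bends_e.
split; first exact: sum_bends_e.
exact: nb_bends_full.
Qed.
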